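(* Let $0<\kappa<1$, $w\in A_1$, $b\in BMO(\mathbb R^n)$, and let $[b,\mathcal T]$ be a linear or sublinear operator such that, for some absolute constant $c_2$, for every $f\in L^1(\mathbb R^n)$ with compact support and every $x\notin \mathrm{supp}\, f$, $$\big|[b,\mathcal T](f)(x)\big|\leq c_2\int_{\mathbb R^n}\frac{|b(x)-b(y)|\cdot|f(y)|}{|x-y|^n}\,dy .$$ Let $\Phi(t)=t(1+\log^+t)$. Suppose that there is a constant $C_0$, depending only on $n$, $w$ and $\|b\|_*$, such that for every $\sigma>0$ and every $f\in L^1(\mathbb R^n)$ with compact support, $$w\big(\{x\in\mathbb R^n:|[b,\mathcal T](f)(x)|>\sigma\}\big)\leq C_0\int_{\mathbb R^n}\Phi\left(\frac{|f(x)|}{\sigma}\right) w(x)\,dx .$$ Then there exists a constant $C>0$ such that for every $f\in L^1(\mathbb R^n)$ with compact support, every $\sigma>0$ and every ball $B\subset\mathbb R^n$, $$\frac{1}{w(B)^\kappa}\, w\big(\{x\in B:|[b,\mathcal T](f)(x)|>\sigma\}\big)\leq C\sup_{B'}\frac{1}{w(B')^\kappa}\int_{B'}\Phi\left(\frac{|f(x)|}{\sigma}\right) w(x)\,dx ,$$ where the supremum is over all balls $B'\subset\mathbb R^n$ (the constant $C$ is independent of $f$, $B$ and $\sigma$).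
   Context: The symbol $[b,\mathcal T]$ is the name of an abstract operator mapping functions $f$ to measurable functions on $\mathbb R^n$; only the properties listed in the claim are assumed. Sublinear means in particular $|[b,\mathcal T](f+g)|\le |[b,\mathcal T](f)|+|[b,\mathcal T](g)|$. A weight is a non-negative locally integrable function on $\mathbb R^n$ that is positive on a set of positive measure; $w(E)=\int_E w(x)\,dx$. $w\in A_1$ means there is a constant $C$ with $\frac1{|B|}\int_B w\,dx\le C\,\mathrm{ess\,inf}_{x\in B}w(x)$ for every ball $B$. $BMO(\mathbb R^n)$ is the space of locally integrable $b$ with $\|b\|_*=\sup_B\frac1{|B|}\int_B|b(x)-b_B|\,dx<\infty$, where $b_B=\frac1{|B|}\int_B b$. $\log^+t=\max(\log t,0)$, with $\Phi(0)=0$. The right-hand side may be infinite. *)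

(* Defs.v *)
From HB Require Import structures.
From mathcomp Require Import all_boot all_order all_algebra.
From mathcomp Require Import all_classical all_reals all_analysis ess_sup_inf.

Set Implicit Arguments.
Unset Strict Implicit.
Unset Printing Implicit Defensive.

Import Order.TTheory GRing.Theory Num.Theory.
Import numFieldNormedType.Exports.

Local Open Scope classical_set_scope.
Local Open Scope ring_scope.
Local Open Scope ereal_scope.

(* R^n carries the topology of 'rV[R]_n and, below, the sigma-algebra of
   Lebesgue measurable sets (not only the Borel sets). *)
Definition Rn (R : realType) (n : nat) : Type := 'rV[R]_n.

HB.instance Definition _ (R : realType) (n : nat) :=
  NormedModule.on (Rn R n).

Section lebesgue_measure_Rn.
Variables (R : realType) (n : nat).
Implicit Types (p : Rn R n * Rn R n) (C : set (Rn R n * Rn R n))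
  (X : set (Rn R n)).

Definition box p : set (Rn R n) :=
  [set x | forall i, (p.1 ord0 i < x ord0 i <= p.2 ord0 i)%R].

Definition box_vol p : R :=
  (\prod_(i < n) Num.max 0 (p.2 ord0 i - p.1 ord0 i))%R.

(* Covers are countable, possibly empty, families of boxes: allowing the empty
   family keeps the value on set0 equal to 0 when n = 0. *)
Definition box_cover X C := countable C /\ X `<=` \bigcup_(p in C) box p.

Definition leb_outer X : \bar R :=
  ereal_inf [set \esum_(p in C) (box_vol p)%:E | C in box_cover X].

Let vol_ge0 p : 0 <= (box_vol p)%:E.
Proof. by rewrite lee_fin; apply: prodr_ge0 => i _; rewrite le_max lexx. Qed.

Lemma leb_outer_ge0 X : 0 <= leb_outer X.
Proof. by apply: le_ereal_inf_tmp => _ [C _ <-]; exact: esum_ge0. Qed.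

Lemma leb_outer0 : leb_outer set0 = 0.
Proof.
apply/eqP; rewrite eq_le leb_outer_ge0 andbT; apply: ereal_inf_lbound.
by exists set0; [split => //; exact: countable0 | rewrite esum_set0].
Qed.

Lemma le_leb_outer : {homo leb_outer : A B / A `<=` B >-> A <= B}.
Proof.
move=> A B AB; apply: ereal_inf_le_tmp => _ [C [cC BC] <-].
by exists C => //; split => //; exact: subset_trans BC.
Qed.

Lemma leb_outer_sigma_subadditive : sigma_subadditive leb_outer.
Proof.
move=> A; have [[i ioo]|] := pselect (exists i, leb_outer (A i) = +oo).
  rewrite (eseries_pinfty _ _ ioo) ?leey// => k _.
  by rewrite -ltNye (lt_le_trans _ (leb_outer_ge0 _)).
rewrite -forallNE => Aoo.
apply/lee_addgt0Pr => e e0.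
rewrite (le_trans _ (epsilon_trick _ _ (ltW e0)))//; last first.
  by move=> k; exact: leb_outer_ge0.
have /choice[G PG] (k : nat) : exists C, box_cover (A k) C /\
    \esum_(p in C) (box_vol p)%:E <=
      leb_outer (A k) + (e / (2 ^ k.+1)%:R)%:E.
  have ek : (0 < e / (2 ^ k.+1)%:R)%R by rewrite divr_gt0// ltr0n expn_gt0.
  have /(lb_ereal_inf_adherent ek) : leb_outer (A k) \is a fin_num.
    by rewrite ge0_fin_numE ?leb_outer_ge0// ltey; apply/eqP/Aoo.
  by move=> [_ [C AC <-] /ltW CA]; exists C.
apply: (@le_trans _ _ (\sum_(k <oo) \esum_(p in G k) (box_vol p)%:E)); last first.
  apply: lee_nneseries => [k _ _|k _]; first exact: esum_ge0.
  exact: (PG k).2.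
apply: (@le_trans _ _ (\esum_(p in \bigcup_k G k) (box_vol p)%:E)).
  apply: ereal_inf_lbound; exists (\bigcup_k G k) => //; split.
    by apply: bigcup_countable => // k _; exact: (PG k).1.1.
  move=> x [k _ /(PG k).1.2[p Gp px]].
  by exists p => //; exists k.
rewrite seqDU_bigcup_eq esum_bigcupT//.
rewrite -nneseries_esumT; last by move=> k; exact: esum_ge0.
apply: lee_nneseries => [k _ _|k _]; first exact: esum_ge0.
rewrite [leLHS]esum_mkcond [leRHS]esum_mkcond.
apply: le_esum => p _; case: ifPn => [/set_mem pG|_]; last first.
  by case: ifPn.
by rewrite ifT//; apply/mem_set; exact: (subset_seqDU pG).
Qed.

HB.instance Definition _ := isOuterMeasure.Build R (Rn R n) leb_outer
  leb_outer0 leb_outer_ge0 le_leb_outer leb_outer_sigma_subadditive.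

HB.instance Definition _ := @isMeasurable.Build
  (caratheodory_display leb_outer) (Rn R n) leb_outer.-caratheodory
  (caratheodory_measurable_set0 leb_outer)
  (@caratheodory_measurable_setC _ _ leb_outer)
  (@caratheodory_measurable_bigcup _ _ leb_outer).

Definition leb : set (Rn R n) -> \bar R := leb_outer.

HB.instance Definition _ := isMeasure.Build _ (Rn R n) R leb
  leb_outer0 leb_outer_ge0 (@caratheodory_measure_sigma_additive _ _ leb_outer).

End lebesgue_measure_Rn.

Arguments leb {R n}.

Section weights_and_BMO.
Variables (R : realType) (n : nat).
Implicit Types (f w b : Rn R n -> R) (B E : set (Rn R n)).

(* The norm of 'rV[R]_n in the library is the sup norm. *)
Definition enorm (x : Rn R n) : R := Num.sqrt (\sum_(i < n) x ord0 i ^+ 2)%R.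

Definition eucl_ball B := exists (c : Rn R n) (r : R),
  (0 < r)%R /\ B = [set x | (enorm (x - c)%R < r)%R].

Definition supp f : set (Rn R n) := closure [set x | f x != 0%R].

Definition L1_compact_supp f :=
  leb.-integrable [set: Rn R n] (EFin \o f) /\ compact (supp f).

Definition loc_integrable f := measurable_fun [set: Rn R n] f /\
  forall K, compact K -> \int[leb]_(x in K) (`|f x|%R)%:E < +oo.

Definition is_weight w := [/\ forall x, (0 <= w x)%R, loc_integrable w &
  0 < leb [set x | (0 < w x)%R]].

Definition weight_measure w E : \bar R := \int[leb]_(x in E) (w x)%:E.

(* Giving w the value +oo off B makes the global essential infimum the one
   over B. *)
Definition ess_inf_on w B : \bar R := ess_inf leb (patch (cst +oo) B (EFin \o w)).

Definition muckenhoupt_A1 w := is_weight w /\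
  exists C : R, forall B, eucl_ball B ->
    (leb B)^-1 * weight_measure w B <= C%:E * ess_inf_on w B.

Definition ball_mean b B : R :=
  ((fine (leb B))^-1 * \int[leb]_(x in B) b x)%R.

Definition BMO_norm b : \bar R := ereal_sup
  [set (leb B)^-1 * \int[leb]_(x in B) (`|b x - ball_mean b B|%R)%:E | B in eucl_ball].

Definition BMO b := loc_integrable b /\ BMO_norm b < +oo.

(* ln 0 = 0 in the library, so Phi 0 = 0. *)
Definition Phi (t : R) : R := (t * (1 + Num.max (ln t) 0))%R.

End weights_and_BMO.

Arguments eucl_ball {R n}.

(* Identities and inequalities between the measurable functions T f are
   understood almost everywhere. *)
Section operators.
Variables (R : realType) (n : nat) (T : (Rn R n -> R) -> (Rn R n -> R)).

Definition linear_operator := forall (a : R) (f g : Rn R n -> R),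
  L1_compact_supp f -> L1_compact_supp g ->
  {ae leb, forall x, T (fun y => a * f y + g y)%R x = (a * T f x + T g x)%R}.

Definition sublinear_operator := forall f g : Rn R n -> R,
  L1_compact_supp f -> L1_compact_supp g ->
  {ae leb, forall x, (`|T (fun y => f y + g y) x| <= `|T f x| + `|T g x|)%R}.

End operators.

(* Main.v *)
Require Import Defs.
From HB Require Import structures.
From mathcomp Require Import all_boot all_order all_algebra.
From mathcomp Require Import all_classical all_reals all_analysis.
From mathcomp Require Import measurable_realfun ess_sup_inf.
From mathcomp Require Import ring lra.
Import Order.TTheory GRing.Theory Num.Theory.
Import numFieldNormedType.Exports.
Local Open Scope classical_set_scope.
Local Open Scope ring_scope.
Local Open Scope ereal_scope.

(** Fix a ball [B] of centre [x0] and radius [r], let [Q_i] be the cube of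
centre [x0] and half side [2 ^ i * r], and split [f = f1 + f2] with [f1]
supported in [Q_1]. By (sub)linearity it is enough to bound the weights of the
sets where [|T f1|] and, inside [B], [|T f2|] exceed [sigma / 2]. Write [S] for
the supremum on the right-hand side.

For [f1] the weak type hypothesis gives the bound [C * S * w(Q_1) ^ kappa], as
[Phi (2 t) <= 4 * Phi t], and [w(Q_1)] is comparable to [w(B)] because an [A1]
weight is doubling ([near_part], [A1_doubling]).

For [f2] and [x] in [B] the kernel is at most a multiple of [|Q_i| ^ -1] at the
points of [Q_i] outside [Q_(i-1)], and the [A1] condition replaces averages for
Lebesgue measure by averages for [w] ([kernel_integral_le]). With
[g = |f2| / sigma] and a constant [t] close to the mean of [b] on [Q_0], one has
to sum over [i] the [w]-averages on [Q_i] of [|b x - t| * g] and of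
[|b - t| * g].

- The average of [g] is at most [S * w(Q_i) ^ (kappa - 1)], and this is summable
  because [w(Q_i)] grows geometrically: an [A1] weight gives at least the
  proportion [1 / (2 A)] of its mass to the complement of a set that fills at
  most half of a cube ([A1_small], [tail_linear]).
- The average of [|b - t| * g] cannot be controlled by that of [Phi g] alone, as
  is seen on characteristic functions of small sets. Young's inequality with a
  parameter [l] ([Phi_young]) bounds it by [l] times an average of
  [exp (rate * |b - t|)] plus [1 - ln l] times the average of [Phi g]. With [l]
  equal to a small [d] times a geometric sequence in [i], the first terms have a
  sum of at most a quarter of [sigma], and in the second the factor
  [1 - ln l] is linear in [i] and is absorbed by the geometric decay
  ([tail_log]).

Hence where [|T f2|] exceeds [sigma / 2], an affine function of [|b x - t|]
times [S * w(Q_0) ^ (kappa - 1)] is bounded below, and Chebyshev's inequality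
concludes, since the [w]-average of [|b - t|] on [Q_0] is bounded
([far_estimate]).

The exponential integrability of [b] with respect to [w] is a John-Nirenberg
inequality proved directly for the weight ([weighted_john_nirenberg]): in the
usual iteration of the Calderon-Zygmund decomposition, the selected cubes fill at
most half of the given cube, and [A1_small] turns this into a fixed proportion
of the weight. The decomposition rests on a dyadic differentiation argument
([dyadic_averages_null]) for the outer measure defined by boxes. *)

Set Implicit Arguments.
Unset Strict Implicit.
Unset Printing Implicit Defensive.

(** * Lebesgue outer measure of boxes and cubes *)

Lemma esum_subset (R : realType) (T : choiceType) (P Q : set T)
    (a : T -> \bar R) :
  P `<=` Q -> \esum_(i in P) a i <= \esum_(i in Q) a i.
Proof.
move=> PQ; rewrite ge_ereal_sup => //= _ [X [finX XP] <-].
by rewrite esum_ge//; exists X => //; split => //; exact: subset_trans PQ.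
Qed.

Lemma esum_image_le (R : realType) (T T' : choiceType) (P : set T)
    (g : T -> T') (a : T' -> \bar R) :
  \esum_(j in g @` P) a j <= \esum_(i in P) a (g i).
Proof.
have [->|/set0P[p0 Pp0]] := eqVneq P set0; first by rewrite image_set0 !esum_set0.
have /choice[h hP] (q : T') : exists p, (g @` P) q -> P p /\ g p = q.
  have [[p Pp gpq]|nq] := pselect ((g @` P) q); first by exists p.
  by exists p0.
have -> : \esum_(j in g @` P) a j = \esum_(j in g @` P) a (g (h j)).
  by apply: eq_esum => q /hP[_ ->].
rewrite -(esum_image (g @` P) h (fun i => a (g i))).
  by apply: esum_subset => _ [q /hP[Ph _] <-].
by move=> x y /set_mem/hP[_ {2}<-] /set_mem/hP[_ {2}<-] ->.
Qed.

Lemma esumZl_le (R : realType) (T : choiceType) (P : set T) (k : R)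
    (a : T -> R) :
  (0 <= k)%R -> (forall i, 0 <= a i)%R ->
  \esum_(i in P) (k * a i)%:E <= k%:E * \esum_(i in P) (a i)%:E.
Proof.
move=> k0 a0; rewrite ge_ereal_sup => //= _ [F [finF FP] <-].
under eq_fsbigr do rewrite EFinM.
rewrite -ge0_mule_fsumr; last by move=> p; rewrite lee_fin.
by apply: lee_wpmul2l; rewrite ?lee_fin//; apply: ereal_sup_ubound; exists F.
Qed.

Lemma max0_split (R : realType) (p q a : R) :
  (Num.max 0 (q - p) = Num.max 0 (Num.min q a - p) +
    Num.max 0 (q - Num.max p a))%R.
Proof.
case: (leP q a) => qa; case: (leP p a) => pa;
  case: (leP 0%R (q - p)%R) => ?; case: (leP 0%R (q - a)%R) => ?;
  case: (leP 0%R (a - p)%R) => ?; lra.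
Qed.

Section lebesgue_Rn.
Context {R : realType} {n : nat}.
Notation V := (Rn R n).
Implicit Types (X : set V) (C : set (V * V)) (p : V * V).

Lemma box_vol_ge0 p : (0 <= box_vol p)%R.
Proof. by apply: prodr_ge0 => i _; rewrite le_max lexx. Qed.

Lemma leb_outer_le_esum X C (g : V * V -> V * V) :
    countable C -> X `<=` \bigcup_(p in C) box (g p) ->
  leb_outer X <= \esum_(p in C) (box_vol (g p))%:E.
Proof.
move=> cC XC; apply: le_trans (esum_image_le C g (fun q => (box_vol q)%:E)).
apply: ereal_inf_lbound; exists (g @` C) => //; split.
  exact: card_le_trans (card_image_le _ _) cC.
by move=> x /XC[p Cp gx]; exists (g p) => //; exists p.
Qed.

Definition set_coord (i : 'I_n) (t : R) (x : V) : V :=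
  (\row_j if j == i then t else x ord0 j)%R.

(** A half-space cuts a box into two boxes whose volumes add up, so every cover
splits without loss. *)
Lemma halfspace_caratheodory (i : 'I_n) (a : R) :
  (@leb_outer R n).-caratheodory [set x | (x ord0 i <= a)%R].
Proof.
apply: le_caratheodory_measurable => X.
apply: le_ereal_inf_tmp => _ [C [cC XC] <-].
pose g1 p : V * V := (p.1, set_coord i (Num.min (p.2 ord0 i) a) p.2).
pose g2 p : V * V := (set_coord i (Num.max (p.1 ord0 i) a) p.1, p.2).
have E p : box_vol p = (box_vol (g1 p) + box_vol (g2 p))%R.
  have D q : box_vol q = (Num.max 0 (q.2 ord0 i - q.1 ord0 i) *
      \prod_(j < n | j != i) Num.max 0 (q.2 ord0 j - q.1 ord0 j))%R.
    by rewrite /box_vol (bigD1 i).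
  rewrite !D/= !mxE eqxx.
  under [in X in (_ = _ * X + _)%R]eq_bigr => j /negbTE ji do rewrite mxE ji.
  under [in X in (_ = _ + _ * X)%R]eq_bigr => j /negbTE ji do rewrite mxE ji.
  rewrite -mulrDl; congr (_ * _)%R.
  exact: max0_split.
rewrite [leRHS](eq_esum (b := fun p => (box_vol (g1 p))%:E + (box_vol (g2 p))%:E)); last first.
  by move=> p _; rewrite E EFinD.
rewrite esumD; try by move=> p _; rewrite lee_fin box_vol_ge0.
apply: leeD; apply: leb_outer_le_esum => // x [/XC[p Cp px] /= xa];
  exists p => // j; have /andP[lo hi] := px j; rewrite /= !mxE.
  by case: eqP => [ji|_]; rewrite ?lo ?hi// le_min -ji hi ji xa.
case: eqP => [ji|_]; rewrite ?lo ?hi// gt_max -ji lo ji andbT/=.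
by rewrite ltNge; apply/negP.
Qed.

Lemma measurable_coord (i : 'I_n) :
  measurable_fun [set: V] (fun x : V => x ord0 i).
Proof.
move=> mD; apply: (measurability _ (RGenOInfty.measurableE R)) => //.
move=> _ [_ [a ->] <-]; rewrite setTI.
have -> : (fun x : V => x ord0 i) @^-1` `]a, +oo[ =
    ~` [set x : V | (x ord0 i <= a)%R].
  by apply/seteqP; split => x /=; rewrite in_itv/= andbT ltNge => /negP.
apply: measurableC; exact: halfspace_caratheodory.
Qed.

Lemma measurable_box p : measurable (box p : set V).
Proof.
have -> : box p = \bigcap_(i in [set: 'I_n])
    (fun x : V => x ord0 i) @^-1` (`](p.1 ord0 i), (p.2 ord0 i)]%classic).
  apply/seteqP; split => [x h i _|x h i] /=.
    by rewrite in_itv/=; exact: h.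
  by have := h i Logic.I; rewrite /= in_itv.
apply: fin_bigcap_measurable => // i _; rewrite -[X in measurable X]setTI.
exact: measurable_coord.
Qed.

(** A homothety maps boxes to boxes, hence covers of [X] to covers of its
image; its inverse gives the opposite inequality. *)
Lemma leb_outer_homothety_le (c : V) (s : R) X : (0 < s)%R ->
  leb_outer ((fun x : V => c + s *: x)%R @` X) <= (s ^+ n)%:E * leb_outer X.
Proof.
move=> s0; have sn0 : (0 < s ^+ n)%R by rewrite exprn_gt0.
rewrite -lee_pdivrMl//; apply: le_ereal_inf_tmp => _ [C [cC XC] <-].
rewrite lee_pdivrMl//.
pose g p : V * V := (c + s *: p.1, c + s *: p.2)%R.
have E p : (box_vol (g p) = s ^+ n * box_vol p)%R.
  rewrite /box_vol -[in (s ^+ n)%R](card_ord n) -prodr_const -big_split/=.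
  apply: eq_bigr => i _; rewrite !mxE maxr_pMr ?ltW// mulr0; congr (Num.max _ _).
  by ring.
apply: (@le_trans _ _ (\esum_(p in C) (s ^+ n * box_vol p)%:E)).
  rewrite (eq_esum (b := fun p => (box_vol (g p))%:E)) => [|p _]; last by rewrite E.
  apply: leb_outer_le_esum => // _ [x /XC[p Cp px] <-]; exists p => // i.
  by have := px i; rewrite !mxE ltrD2l lerD2l ltr_pM2l// ler_pM2l.
by apply: esumZl_le => [|p]; [exact: ltW|exact: box_vol_ge0].
Qed.

Lemma leb_outer_homothety (c : V) (s : R) X : (0 < s)%R ->
  leb_outer ((fun x : V => c + s *: x)%R @` X) = (s ^+ n)%:E * leb_outer X.
Proof.
move=> s0; apply/eqP; rewrite eq_le leb_outer_homothety_le//=.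
set Y := ((fun x : V => c + s *: x)%R @` X).
have XY : X = (fun y : V => - (s^-1 *: c) + s^-1 *: y)%R @` Y.
  apply/seteqP; split => [x Xx|_ [_ [x Xx <-] <-]].
    exists (c + s *: x)%R; first by exists x.
    by rewrite scalerDr scalerA mulVf ?gt_eqF// scale1r addKr.
  by rewrite scalerDr scalerA mulVf ?gt_eqF// scale1r addKr.
rewrite -lee_pdivlMl ?exprn_gt0// [in leLHS]XY -exprVn.
by apply: leb_outer_homothety_le; rewrite invr_gt0.
Qed.

Definition cube (c : V) (s : R) : set V := box (c, c + const_mx s)%R.

Lemma cubeP c s x :
  cube c s x <-> forall i, (c ord0 i < x ord0 i <= c ord0 i + s)%R.
Proof. by split => h i; have := h i; rewrite /= !mxE. Qed.

Lemma measurable_cube c s : measurable (cube c s).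
Proof. exact: measurable_box. Qed.

(** Kept as a symbol: it cancels in every comparison of cubes. *)
Definition unit_vol : R := fine (@leb R n (cube 0%R 1%R)).

Lemma leb_unit_cube : @leb R n (cube 0%R 1%R) = unit_vol%:E.
Proof.
rewrite fineK// ge0_fin_numE//.
apply: (@le_lt_trans _ _ (box_vol ((0:V)%R, ((0:V) + const_mx 1)%R))%:E);
  last exact: ltry.
apply: ereal_inf_lbound; exists [set ((0:V)%R, ((0:V) + const_mx 1)%R)].
  by split; [exact: countable1|move=> x hx; exists ((0:V)%R, ((0:V) + const_mx 1)%R)].
by rewrite esum_set1// lee_fin box_vol_ge0.
Qed.

Lemma cube_homothety c s : (0 < s)%R ->
  cube c s = (fun x : V => c + s *: x)%R @` cube 0%R 1%R.
Proof.
move=> s0; apply/seteqP; split => [x /cubeP cx|_ [x /cubeP cx <-]].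
  exists (s^-1 *: (x - c))%R; last first.
    by rewrite scalerA mulfV ?gt_eqF// scale1r subrKC.
  apply/cubeP => i; have /andP[lo hi] := cx i; rewrite !mxE add0r.
  by rewrite mulr_gt0 ?invr_gt0 ?subr_gt0//= mulrC ler_pdivrMr// mul1r lerBlDl.
apply/cubeP => i; have := cx i; rewrite !mxE add0r => /andP[lo hi].
by rewrite ltrDl mulr_gt0//= lerD2l -[leRHS]mulr1 ler_pM2l.
Qed.

Lemma leb_cube c s : (0 < s)%R -> leb (cube c s) = (s ^+ n * unit_vol)%:E.
Proof.
by move=> s0; rewrite cube_homothety// EFinM -leb_unit_cube; exact: leb_outer_homothety.
Qed.

Lemma measurable_enorm c : measurable_fun [set: V] (fun x : V => enorm (x - c)%R).
Proof.
apply: (measurableT_comp (continuous_measurable_fun (@sqrt_continuous R))).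
apply: measurable_sum => i; apply: measurable_funX.
rewrite (_ : (fun x : V => _) = (fun x : V => x ord0 i - c ord0 i)%R); last first.
  by apply/funext => x; rewrite !mxE.
by apply: measurable_funB; [exact: measurable_coord|exact: measurable_cst].
Qed.

Definition eball c r : set V := [set x | (enorm (x - c)%R < r)%R].

Lemma measurable_eball c r : measurable (eball c r).
Proof.
rewrite -[eball c r]setTI.
rewrite (_ : eball c r = (fun x : V => enorm (x - c)%R) @^-1` `]-oo, r[).
  exact: measurable_enorm.
by apply/seteqP; split => x; rewrite /eball/= in_itv.
Qed.

Lemma coord_le_enorm (x : V) i : (`|x ord0 i| <= enorm x)%R.
Proof.
rewrite -sqrtr_sqr ler_wsqrtr// (bigD1 i)//= lerDl.
by apply: sumr_ge0 => j _; exact: sqr_ge0.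
Qed.

Lemma enorm_le (x : V) (h : R) : (0 <= h)%R -> (forall i, `|x ord0 i| <= h)%R ->
  (enorm x <= n%:R * h)%R.
Proof.
move=> h0 xh; rewrite -(ler_sqr (sqrtr_ge0 _) (mulr_ge0 _ h0))//.
rewrite sqr_sqrtr; last by apply: sumr_ge0 => j _; exact: sqr_ge0.
apply: (@le_trans _ _ (\sum_(i < n) h ^+ 2)%R).
  apply: ler_sum => i _; rewrite -real_normK ?num_real//.
  by rewrite ler_sqr ?nnegrE.
rewrite sumr_const card_ord -[leLHS]mulr_natl exprMn; apply: ler_wpM2r; first exact: sqr_ge0.
by rewrite -natrX ler_nat; case: (n) => // m; rewrite leq_pmulr.
Qed.

(** Cubes centred at [c]; the half side is the natural parameter when they are
compared with balls. *)
Definition ccube c (h : R) : set V := cube (c - const_mx h)%R (h *+ 2).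

Lemma ccubeP c h x :
  ccube c h x <-> forall i, (c ord0 i - h < x ord0 i <= c ord0 i + h)%R.
Proof.
rewrite /ccube cubeP; split=> cx i; have := cx i; rewrite !mxE.
  by rewrite mulr2n addrA subrK.
by rewrite mulr2n addrA subrK.
Qed.

Lemma eball_sub_ccube c r : eball c r `<=` ccube c r.
Proof.
move=> x xr; apply/ccubeP => i.
have := le_lt_trans (coord_le_enorm (x - c)%R i) xr.
by rewrite !mxE ltr_norml => /andP[? ?]; lra.
Qed.

Lemma ccube_sub_eball c h r : (0 <= h)%R -> (n%:R * h < r)%R ->
  ccube c h `<=` eball c r.
Proof.
move=> h0 hr x /ccubeP xh; apply: le_lt_trans hr; apply: enorm_le => // i.
by have /andP[? ?] := xh i; rewrite !mxE ler_norml; lra.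
Qed.

Lemma ccube_sub c h h' : (h <= h')%R -> ccube c h `<=` ccube c h'.
Proof.
move=> hh x /ccubeP xh; apply/ccubeP => i; have /andP[? ?] := xh i; lra.
Qed.

Lemma bigcup_ccube c : \bigcup_(k in [set: nat]) ccube c k.+1%:R = [set: V].
Proof.
apply/seteqP; split => // x _; exists (Num.truncn (enorm (x - c)%R)) => //.
by apply: (@eball_sub_ccube c); exact: truncnS_gt.
Qed.

Lemma measurable_ccube c h : measurable (ccube c h).
Proof. exact: measurable_box. Qed.

Lemma leb_ccube c h : (0 < h)%R ->
  leb (ccube c h) = ((h *+ 2) ^+ n * unit_vol)%:E.
Proof. by move=> h0; rewrite leb_cube// mulrn_wgt0. Qed.

Lemma unit_vol_ge0 : (0 <= unit_vol)%R.
Proof. by rewrite fine_ge0// measure_ge0. Qed.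

(** If the unit cube were null, all cubes would be null by homogeneity, and so
would the whole space. *)
Lemma unit_vol_gt0 (E : set V) : measurable E -> 0 < leb E -> (0 < unit_vol)%R.
Proof.
move=> mE E0; rewrite lt_neqAle unit_vol_ge0 andbT; apply/eqP => u0.
suff : leb [set: V] = 0.
  move=> T0; move: E0; rewrite lt_neqAle eq_sym => /andP[/eqP + _]; apply.
  by apply: (subset_measure0 mE measurableT) => //; exact: T0.
apply/eqP; rewrite eq_le measure_ge0 andbT -(bigcup_ccube 0%R).
apply: le_trans (leb_outer_sigma_subadditive _) _.
by rewrite eseries0// => k _ _; rewrite -/(leb _) leb_ccube// -u0 mulr0.
Qed.

(** Local integrability is a condition on compact sets. *)
Lemma cube_sub_compact c s : exists K : set V,
  [/\ compact K, measurable K & cube c s `<=` K].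
Proof.
pose K := [set x : V | forall i, `[c ord0 i, (c ord0 i + s)%R]%classic (x ord0 i)].
exists K; split.
- apply: (@rV_compact R n (fun i => `[c ord0 i, (c ord0 i + s)%R]%classic)) => i.
  exact: segment_compact.
- have -> : K = \bigcap_(i in [set: 'I_n])
      (fun x : V => x ord0 i) @^-1` `[c ord0 i, (c ord0 i + s)%R]%classic.
    by apply/seteqP; split => [x h i _|x h i]; exact: h.
  apply: fin_bigcap_measurable => // i _; rewrite -[X in measurable X]setTI.
  exact: measurable_coord.
- move=> x /cubeP cx i; have /andP[lo hi] := cx i.
  by rewrite /= in_itv/= ltW.
Qed.

Lemma loc_integrable_cube (f : V -> R) c s : loc_integrable f ->
  \int[leb]_(x in cube c s) (`|f x|%R)%:E < +oo.
Proof.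
move=> [mf fK]; have [K [cK mK QK]] := cube_sub_compact c s.
apply: le_lt_trans (fK _ cK); apply: ge0_subset_integral => //.
  exact: measurable_cube.
by apply/measurable_EFinP; apply: measurableT_comp => //; exact: measurable_funTS.
Qed.

End lebesgue_Rn.
Arguments unit_vol : clear implicits.

(** * Dyadic cubes *)

Section dyadic.
Context {R : realType} {n : nat}.
Notation V := (Rn R n).
Variables (c : V) (s : R).
Hypothesis s_gt0 : (0 < s)%R.
Notation index := {ffun 'I_n -> int}.

Definition dside (k : nat) : R := (s / 2 ^+ k)%R.

(** Cubes being open below and closed above, the index of the cell of [x] is
given by a ceiling. *)
Definition dindex (k : nat) (x : V) : index :=
  [ffun i => Num.ceil ((x ord0 i - c ord0 i) / dside k) - 1]%R.

Definition dcorner (k : nat) (m : index) : V :=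
  (\row_i (c ord0 i + dside k * (m i)%:~R))%R.

Definition dcube (k : nat) (m : index) : set V := cube (dcorner k m) (dside k).

Definition dparent (m : index) : index := [ffun i => (m i %/ 2)%Z].

Lemma dside_gt0 k : (0 < dside k)%R.
Proof. by rewrite divr_gt0// exprn_gt0. Qed.

Lemma dcubeP k m x : dcube k m x <-> dindex k x = m.
Proof.
have k0 := dside_gt0 k.
have E i : (dcorner k m ord0 i < x ord0 i <= dcorner k m ord0 i + dside k)%R =
    (dindex k x i == m i).
  rewrite ffunE subr_eq ceil_eq addrK !mxE intrD.
  rewrite ltr_pdivlMr// ler_pdivrMr// ltrBrDl lerBlDl mulrDl mul1r addrA.
  by rewrite [(_%:~R * _)%R]mulrC.
rewrite /dcube cubeP; split => [h|e i]; last by rewrite E e.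
by apply/ffunP => i; apply/eqP; rewrite -E.
Qed.

Lemma dcube0 : dcube 0 [ffun=> 0%R] = cube c s.
Proof.
rewrite /dcube /dside expr0 divr1; congr cube.
by apply/rowP => i; rewrite !mxE ffunE mulr0 addr0.
Qed.

Lemma dindex_parent k x : dindex k x = dparent (dindex k.+1 x).
Proof.
apply/ffunP => i; rewrite [RHS]ffunE.
set m := dindex k.+1 x i.
have : (m%:~R < (x ord0 i - c ord0 i) / dside k.+1 <= (m + 1)%:~R)%R.
  by have := ceil_itv ((x ord0 i - c ord0 i) / dside k.+1)%R; rewrite /m ffunE subrK.
have -> : ((x ord0 i - c ord0 i) / dside k.+1 =
    (x ord0 i - c ord0 i) / dside k * 2)%R.
  by rewrite /dside exprS; field; rewrite expf_neq0//= gt_eqF.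
rewrite ffunE; set t := ((_ - _) / dside k)%R => /andP[lo hi].
apply/eqP; rewrite subr_eq ceil_eq addrK intrD.
have := divz_eq m 2; have := modz_ge0 m (_ : 2 != 0)%R; have := ltz_pmod m (_ : 0 < 2)%R.
set q := (m %/ 2)%Z; set r := (m %% 2)%Z => /(_ isT) r2 /(_ isT) r0 mE.
have {}r2 : (r%:~R <= 1 :> R)%R by rewrite -[1%R]/(1%:~R)%R ler_int -ltzD1.
have {}r0 : (0 <= r%:~R :> R)%R by rewrite ler0z.
clearbody q r.
have two : (2%:~R = 2 :> R)%R by [].
have one : (1%:~R = 1 :> R)%R by [].
move: lo hi; rewrite mE !intrD intrM two one => lo hi.
by apply/andP; split; lra.
Qed.

Lemma dindex_coarser j k x y : (j <= k)%N ->
  dindex k x = dindex k y -> dindex j x = dindex j y.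
Proof.
move=> /subnK <-; elim: (k - j)%N => // d IH; rewrite addSn => e.
by apply: IH; rewrite [LHS]dindex_parent [RHS]dindex_parent e.
Qed.

Lemma dcube_nonempty k m : exists x, dcube k m x.
Proof.
exists (dcorner k m + const_mx (dside k))%R; apply/cubeP => i.
by rewrite !mxE ltrDl dside_gt0 lexx.
Qed.

(** A dyadic cube has finitely many ancestors, so every member of a family [P]
lies in a maximal one. The maximal cubes are listed through the enumeration of
the countable set of indices, with [None] for the other numbers. *)
Lemma dyadic_maximal (P : nat -> index -> Prop) :
  exists q : nat -> option (nat * index),
    let U i := if q i is Some p then dcube p.1 p.2 else set0 in
    [/\ trivIset [set: nat] U,
      forall i k m, q i = Some (k, m) -> P k m /\
        forall x j, dcube k m x -> (j < k)%N -> ~ P j (dindex j x) &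
      forall k m, P k m -> dcube k m `<=` \bigcup_i U i].
Proof.
pose maxi p := P p.1 p.2 /\
  forall x j, dcube p.1 p.2 x -> (j < p.1)%N -> ~ P j (dindex j x).
pose q i : option (nat * index) :=
  if pickle_inv i is Some p then if `[< maxi p >] then Some p else None else None.
have qmax i p : q i = Some p -> maxi p /\ pickle_inv i = Some p.
  rewrite /q; case: (pickle_inv i) => // p'.
  by case: ifPn => // /asboolP h [<-].
exists q => U; split.
- move=> i j _ _ [x []]; rewrite /U.
  case qi: (q i) => [[k m]|//]; case qj: (q j) => [[k' m']|//] /=.
  have [[Pi Mi] pi] := qmax _ _ qi; have [[Pj Mj] pj] := qmax _ _ qj.
  move=> xi xj; have ei := (dcubeP _ _ _).1 xi; have ej := (dcubeP _ _ _).1 xj.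
  have kk' : k = k'.
    case: (ltngtP k k') => // lt; exfalso.
      by apply: (Mj _ _ xj lt); rewrite ei.
    by apply: (Mi _ _ xi lt); rewrite ej.
  have mm : m' = m by rewrite -ei -ej kk'.
  rewrite -kk' mm in pj.
  have := @pickle_invK (nat * index)%type i.
  have := @pickle_invK (nat * index)%type j.
  by rewrite pi pj /= => <- <-.
- by move=> i k m /qmax[].
- move=> k m Pkm x xkm.
  have ex : exists j, `[< P j (dindex j x) >].
    by exists k; apply/asboolP; rewrite ((dcubeP _ _ _).1 xkm).
  case: (ex_minnP ex) => j /asboolP Pj jmin.
  exists (pickle (j, dindex j x)) => //.
  rewrite /U /q pickleK_inv ifT/=; first exact/dcubeP.
  apply/asboolP; split => //= y i /dcubeP yx ij Pi.
  have := jmin i; rewrite leqNgt ij => /(_ _)/negP; apply => //.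
  by apply/asboolP; rewrite -(dindex_coarser (ltnW ij) yx).
Qed.

Lemma dcube_small x (e : R) : (0 < e)%R -> exists k, forall y,
  dcube k (dindex k x) y -> forall i, (`|y ord0 i - x ord0 i| < e)%R.
Proof.
move=> e0; pose k := (Num.truncn (s / e)).+1; exists k => y /dcubeP yx i.
have sk : (dside k < e)%R.
  rewrite /dside ltr_pdivrMr ?exprn_gt0// mulrC -ltr_pdivrMr//.
  apply: lt_le_trans (truncnS_gt _) _.
  by rewrite -/k -natrX ler_nat ltnW// ltn_expl.
have /(dcubeP _ _ _)/cubeP/(_ i)/andP[lx hx] : dindex k x = dindex k x by [].
have /cubeP/(_ i)/andP[ly hy] := (dcubeP _ _ _).2 yx.
by rewrite ltr_norml; apply/andP; split; lra.
Qed.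

Lemma dcube_sub_root k x : cube c s x -> dcube k (dindex k x) `<=` cube c s.
Proof.
rewrite -dcube0 => /dcubeP x0 y /dcubeP yx; apply/dcubeP.
by rewrite -x0; exact: dindex_coarser yx.
Qed.

Lemma leb_dcube k m : leb (dcube k m) = (dside k ^+ n * unit_vol R n)%:E.
Proof. by rewrite leb_cube// dside_gt0. Qed.

End dyadic.

(** * Differentiation along dyadic cubes *)

Lemma uniform_gap (R : realType) (n : nat) (h : 'I_n -> R) :
  (forall i, 0 < h i)%R -> exists e : R, (0 < e)%R /\ forall i, (e <= h i)%R.
Proof.
move=> h0; exists (\big[Num.min/1%R]_i h i)%R; split.
  by apply: lt_bigmin.
by move=> i; exact: bigmin_le.
Qed.

Lemma exprD1_near1 (R : realType) (N : nat) (d : R) : (0 < d)%R ->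
  exists e : R, (0 < e)%R /\ ((1 + e) ^+ N < 1 + d)%R.
Proof.
move=> d0; suff [e [e0 eN]] : exists e : R, (0 < e)%R /\ ((1 + e) ^+ N <= 1 + d / 2)%R.
  by exists e; split => //; apply: le_lt_trans eN _; lra.
have : (0 < d / 2)%R by lra.
elim: N (d / 2)%R => [|N IH] r r0; first by exists 1%R; split => //; rewrite expr0; lra.
have [e [e0 eN]] := IH (r / 2)%R (divr_gt0 r0 (ltr0n _ 2)).
pose f := Num.min e (r / (2 + r))%R.
have f0 : (0 < f)%R by rewrite /f lt_min e0 divr_gt0//; lra.
exists f; split => //; rewrite exprS.
have h1 : ((1 + f) ^+ N <= 1 + r / 2)%R.
  apply: le_trans eN; apply: lerXn2r; rewrite ?nnegrE; [lra|lra|].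
  by rewrite lerD2l /f ge_min lexx.
have h2 : (f * (2 + r) <= r)%R.
  by rewrite -ler_pdivlMr; [rewrite /f ge_min lexx orbT|lra].
apply: (@le_trans _ _ ((1 + f) * (1 + r / 2))%R).
  by rewrite ler_wpM2l// addr_ge0// ltW.
nra.
Qed.

Section differentiation.
Context {R : realType} {n : nat}.
Notation V := (Rn R n).
Variables (c : V) (s : R).
Hypothesis s_gt0 : (0 < s)%R.

Lemma integral_dyadic_union_le (F : V -> \bar R) (lam : R)
    (q : nat -> option (nat * {ffun 'I_n -> int})) :
  let U i := if q i is Some p then dcube c s p.1 p.2 else set0 in
  (0 <= lam)%R -> measurable_fun [set: V] F -> (forall x, 0 <= F x) ->
  trivIset [set: nat] U ->
  (forall i, \int[leb]_(x in U i) F x <= lam%:E * leb (U i)) ->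
  \int[leb]_(x in \bigcup_i U i) F x <= lam%:E * leb (\bigcup_i U i).
Proof.
move=> U lam0 mF F0 tU h.
have mU i : measurable (U i).
  by rewrite /U; case: (q i) => [p|//]; exact: measurable_cube.
rewrite ge0_integral_bigcup//; last exact: measurable_funTS.
rewrite measure_semi_bigcup//; last exact: bigcupT_measurable.
rewrite -nneseriesZl//; apply: lee_nneseries => // i _ _.
exact: integral_ge0.
Qed.

(** A one-sided Lebesgue differentiation theorem. The set [E] is covered by
dyadic cubes whose total measure exceeds that of [E] by a factor arbitrarily
close to 1, and [F] has average at most [lam] on each of them; if [E] had
positive measure, this would contradict [F >= lam + eps] on [E]. *)
Lemma dyadic_averages_null (F : V -> R) (lam eps : R) (E : set V) :
  (0 < lam)%R -> (0 < eps)%R -> measurable_fun [set: V] F ->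
  (forall x, 0 <= F x)%R -> measurable E -> E `<=` cube c s ->
  (forall x k, E x -> \int[leb]_(y in dcube c s k (dindex c s k x)) (F y)%:E
     <= lam%:E * leb (dcube c s k (dindex c s k x))) ->
  (forall x, E x -> lam + eps <= F x)%R ->
  leb E = 0.
Proof.
move=> lam0 eps0 mF F0 mE EQ avg big.
have mFE : measurable_fun [set: V] (EFin \o F) by exact/measurable_EFinP.
have Efin : leb E \is a fin_num.
  rewrite ge0_fin_numE ?measure_ge0//.
  apply: le_lt_trans (le_measure _ _ _ EQ) _.
  - by rewrite inE.
  - by rewrite inE; exact: measurable_cube.
  - by rewrite [X in X < _](leb_cube c s_gt0) ltry.
have [//|E0] := eqVneq (leb E) 0.
have {E0} : 0 < leb E by rewrite lt_neqAle eq_sym E0 measure_ge0.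
move: Efin => /fineK; set e := fine _ => eE; rewrite -eE lte_fin => e0; exfalso.
have [eta [eta0 etaN]] := @exprD1_near1 R n.+1 (eps / lam)%R (divr_gt0 eps0 lam0).
have [_ [C [cC EC] <-] CE] : exists2 x, [set \esum_(p in C) (box_vol p)%:E |
    C in box_cover E] x & x < e%:E + (eta * e)%:E.
  rewrite eE; apply: lb_ereal_inf_adherent; rewrite ?mulr_gt0//.
  by rewrite -/(leb_outer E) -[leb_outer E]/(leb E) -eE.
(* every point of a box is interior to the enlarged box, so that small dyadic
   cubes around it stay inside *)
pose g (p : V * V) : V * V := (p.1, p.2 + eta *: (p.2 - p.1))%R.
have vol p : box_vol (g p) = ((1 + eta) ^+ n * box_vol p)%R.
  rewrite /box_vol -[in (_ ^+ n)%R](card_ord n) -prodr_const -big_split/=.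
  apply: eq_bigr => i _; rewrite !mxE maxr_pMr ?addr_ge0 ?ltW// mulr0.
  by congr (Num.max _ _); ring.
pose P k m := (exists p, C p /\ dcube c s k m `<=` box (g p)) /\
  exists x, E x /\ dcube c s k m x.
have [q [tU qP qU]] := dyadic_maximal c s_gt0 P.
set U := (fun i => _) in tU qU.
have UC : \bigcup_i U i `<=` \bigcup_(p in C) box (g p).
  move=> x [i _]; rewrite /U; case qi: (q i) => [[k m]|//] xkm.
  have [[[p [Cp sub]] _] _] := qP _ _ _ qi.
  by exists p => //; exact: sub.
have EU : E `<=` \bigcup_i U i.
  move=> x Ex; have [p Cp px] := EC _ Ex.
  have [d [d0 dP]] : exists d : R, (0 < d)%R /\ forall i,
      (d <= Num.min (x ord0 i - p.1 ord0 i)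
        (p.2 ord0 i + eta * (p.2 ord0 i - p.1 ord0 i) - x ord0 i))%R.
    apply: uniform_gap => i; have /andP[lo hi] := px i.
    rewrite lt_min subr_gt0 lo/= subr_gt0; apply: (le_lt_trans hi).
    by rewrite ltrDl mulr_gt0// subr_gt0; exact: lt_le_trans lo hi.
  have [k kP] := dcube_small c s_gt0 x d0.
  have xk : dcube c s k (dindex c s k x) x by exact/dcubeP.
  apply: (qU k (dindex c s k x)) => //; split; last by exists x.
  exists p; split => // y /kP yx i; have := dP i; rewrite le_min => /andP[d1 d2].
  by have := yx i; rewrite ltr_norml !mxE => /andP[? ?]; apply/andP; split; lra.
have mU : measurable (\bigcup_i U i).
  apply: bigcupT_measurable => i; rewrite /U.
  by case: (q i) => [p|//]; exact: measurable_cube.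
have lebU : leb (\bigcup_i U i) <= ((1 + eta) ^+ n.+1 * e)%:E.
  apply: (@le_trans _ _ (\esum_(p in C) (box_vol (g p))%:E)).
    exact: leb_outer_le_esum.
  apply: (@le_trans _ _ (((1 + eta) ^+ n)%:E * \esum_(p in C) (box_vol p)%:E)).
    under eq_esum do rewrite vol.
    by apply: esumZl_le => [|p]; rewrite ?box_vol_ge0// exprn_ge0// addr_ge0// ltW.
  rewrite exprSr -mulrA EFinM; apply: lee_wpmul2l.
    by rewrite lee_fin exprn_ge0// addr_ge0// ltW.
  by apply: le_trans (ltW CE) _; rewrite -EFinD lee_fin; lra.
have : ((lam + eps) * e)%:E <= (lam * ((1 + eta) ^+ n.+1 * e))%:E.
  apply: (@le_trans _ _ (\int[leb]_(x in E) (F x)%:E)).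
    rewrite EFinM eE -integral_cst//; apply: ge0_le_integral => //.
    - by move=> x _; rewrite lee_fin addr_ge0// ltW.
    - exact: measurable_funTS.
  apply: (@le_trans _ _ (\int[leb]_(x in \bigcup_i U i) (F x)%:E)).
    apply: ge0_subset_integral => //; first exact: measurable_funTS.
    by move=> x _; rewrite lee_fin.
  apply: (@le_trans _ _ (lam%:E * leb (\bigcup_i U i))).
    apply: integral_dyadic_union_le => //; first exact: ltW.
    move=> i; rewrite /U; case qi: (q i) => [[k m]|]; last by rewrite integral_set0 measure0 mule0.
    have [[_ [x [Ex xkm]]] _] := qP _ _ _ qi.
    by have := avg x k Ex; rewrite ((dcubeP c s_gt0 _ _ _).1 xkm).
  by rewrite EFinM; apply: lee_wpmul2l => //; rewrite lee_fin ltW.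
rewrite lee_fin mulrA ler_pM2r// => h.
have : (lam * (1 + eta) ^+ n.+1 < lam * (1 + eps / lam))%R by rewrite ltr_pM2l.
by rewrite mulrDr mulr1 mulrCA mulfV ?gt_eqF// mulr1 => /(le_lt_trans h); rewrite ltxx.
Qed.

End differentiation.

(** * The Calderon-Zygmund decomposition *)

Section calderon_zygmund.
Context {R : realType} {n : nat}.
Notation V := (Rn R n).

(** The selected cubes are the maximal dyadic subcubes on which the average of
[F] exceeds [lam]. The parent of a selected cube is not selected, whence the
factor [2 ^ n]; at the other points all dyadic averages are at most [lam]. *)
Lemma calderon_zygmund (c : V) (s : R) (F : V -> R) (lam : R) :
  (0 < s)%R -> (0 < lam)%R -> measurable_fun [set: V] F ->
  (forall x, 0 <= F x)%R ->
  \int[leb]_(x in cube c s) (F x)%:E <= lam%:E * leb (cube c s) ->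
  exists q : nat -> option (V * R),
    let U i := if q i is Some p then cube p.1 p.2 else set0 in
    [/\ trivIset [set: nat] U,
      forall i p, q i = Some p -> [/\ (0 < p.2)%R,
        cube p.1 p.2 `<=` cube c s &
        \int[leb]_(x in cube p.1 p.2) (F x)%:E <=
          (2 ^+ n * lam)%:E * leb (cube p.1 p.2)],
      lam%:E * leb (\bigcup_i U i) <= \int[leb]_(x in cube c s) (F x)%:E &
      {ae leb, forall x, cube c s x -> ~ (\bigcup_i U i) x -> (F x <= lam)%R}].
Proof.
move=> s0 lam0 mF F0 FQ.
have mFE D : measurable_fun D (EFin \o F).
  by apply/measurable_EFinP; exact: measurable_funTS.
pose P k m := dcube c s k m `<=` cube c s /\
  lam%:E * leb (dcube c s k m) < \int[leb]_(x in dcube c s k m) (F x)%:E.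
have [q [tU qP qU]] := dyadic_maximal c s0 P.
exists (fun i => omap (fun p => (dcorner c s p.1 p.2, dside s p.1)) (q i)).
set U := (fun i => if q i is Some p then dcube c s p.1 p.2 else set0) in tU qU.
have UE : (fun i => if omap (fun p => (dcorner c s p.1 p.2, dside s p.1)) (q i)
    is Some p then cube p.1 p.2 else set0) = U.
  by apply/funext => j; rewrite /U; case: (q j).
rewrite [X in let U := X in _]UE => {UE}/=.
have UQ i : U i `<=` cube c s.
  rewrite /U; case qi: (q i) => [[k m]|]; last exact: sub0set.
  by have [[]] := qP _ _ _ qi.
have mU i : measurable (U i).
  by rewrite /U; case: (q i) => [p|//]; exact: measurable_cube.
have mUU : measurable (\bigcup_i U i) by exact: bigcupT_measurable.
split => //.
- move=> i p; case qi: (q i) => [[k m]|//] [<-] /=.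
  have [[kmQ Pkm] maxi] := qP _ _ _ qi.
  split; [exact: dside_gt0|exact: kmQ|].
  have [x xkm] := dcube_nonempty c s0 k m.
  (* the root is not selected, so the cube has a parent, which is not selected *)
  case: k qi kmQ Pkm maxi xkm => [|k] qi kmQ Pkm maxi xkm.
    move: Pkm; have -> : dcube c s 0 m = cube c s.
      rewrite -(dcube0 c s); congr (dcube _ _ _ _).
      rewrite -((dcubeP c s0 _ _ _).1 xkm); apply/(dcubeP c s0).
      by rewrite dcube0; exact: kmQ.
    by move=> /(le_lt_trans FQ); rewrite ltxx.
  have nP := maxi x k xkm (ltnSn k).
  have sub : dcube c s k (dindex c s k x) `<=` cube c s.
    by apply: dcube_sub_root => //; exact: kmQ.
  have sub2 : dcube c s k.+1 m `<=` dcube c s k (dindex c s k x).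
    move=> y /(dcubeP c s0) ym; apply/(dcubeP c s0).
    apply: (dindex_coarser (c:=c) s0 (leqnSn k)).
    by rewrite ym; apply/esym/(dcubeP c s0).
  apply: (@le_trans _ _ (\int[leb]_(x in dcube c s k (dindex c s k x)) (F x)%:E)).
    apply: ge0_subset_integral => //; try exact: measurable_cube.
    by move=> ? _; rewrite lee_fin.
  apply: (@le_trans _ _ (lam%:E * leb (dcube c s k (dindex c s k x)))).
    by rewrite leNgt; apply/negP => h; apply: nP.
  rewrite leb_dcube// -/(dcube c s k.+1 m) leb_dcube// -!EFinM lee_fin.
  rewrite [(2 ^+ n * lam)%R]mulrC -!mulrA; apply: ler_wpM2l; first exact: ltW.
  rewrite mulrA -exprMn; apply: ler_wpM2r; first exact: unit_vol_ge0.
  rewrite le_eqVlt; apply/orP; left; apply/eqP; congr (_ ^+ _)%R.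
  by rewrite /dside exprS; field; rewrite expf_neq0.
- apply: (@le_trans _ _ (\int[leb]_(x in \bigcup_i U i) (F x)%:E)); last first.
    apply: ge0_subset_integral => //; first exact: measurable_cube.
      by move=> x _; rewrite lee_fin.
    by move=> x [i _ /UQ].
  rewrite ge0_integral_bigcup//; last by move=> x _; rewrite lee_fin.
  rewrite measure_semi_bigcup// -nneseriesZl//.
  apply: lee_nneseries => [i _ _|i _]; first by rewrite mule_ge0// lee_fin ltW.
  rewrite /U; case qi: (q i) => [[k m]|]; last by rewrite measure0 mule0 integral_set0.
  by have [[_ /ltW]] := qP _ _ _ qi.
- have : {ae leb, forall x, forall j : nat,
      ~ [set x | [/\ cube c s x, ~ (\bigcup_i U i) x & (lam + j.+1%:R^-1 <= F x)%R]] x}.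
    apply/ae_foralln => j; set E := [set x | _].
    have EE : E = cube c s `&` ~` (\bigcup_i U i) `&` (F @^-1` `[(lam + j.+1%:R^-1)%R, +oo[).
      apply/seteqP; split => x.
        by move=> [? ? ?]; split => //=; rewrite in_itv/= andbT.
      by move=> [[? ?]]; rewrite /= in_itv/= andbT.
    have mE : measurable E.
      rewrite EE; apply: measurableI.
        by apply: measurableI; [exact: measurable_cube|exact: measurableC].
      by rewrite -[X in measurable X]setTI; exact: mF.
    exists E; split => //; last by move=> x /=; apply: contra_notP.
    apply: (@dyadic_averages_null _ _ c s s0 F lam j.+1%:R^-1) => //.
    + by move=> x [].
    + move=> x k [xQ xU _]; rewrite leNgt; apply/negP => h; apply: xU.
      apply: (qU k (dindex c s k x)); last exact/(dcubeP c s0).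
      by split => //; exact: dcube_sub_root.
    + by move=> x [].
  apply: filterS => x h xQ xU; apply/ler_addgt0Pr => e e0.
  have := h (Num.truncn e^-1).
  apply: contra_notP => /negP; rewrite -ltNge => /ltW Fx; split => //.
  apply: le_trans Fx; rewrite lerD2l invf_ple ?posrE// ltW//.
  exact: truncnS_gt.
Qed.

End calderon_zygmund.

(** * Weighted measure and the A1 condition on cubes *)

Section weights.
Context {R : realType} {n : nat}.
Notation V := (Rn R n).
Variable w : V -> R.
Hypothesis w_ge0 : forall x, (0 <= w x)%R.
Hypothesis mw : measurable_fun [set: V] w.
Notation W := (weight_measure w).

Lemma measurable_EFinw D : measurable_fun D (EFin \o w).
Proof. by apply/measurable_EFinP; exact: measurable_funTS. Qed.

Lemma weight_measure_ge0 E : 0 <= W E.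
Proof. by apply: integral_ge0 => x _; rewrite lee_fin. Qed.

Lemma le_weight_measure_ae E F : measurable E -> measurable F ->
  {ae leb, forall x, E x -> F x} -> W E <= W F.
Proof.
move=> mE mF EF; rewrite /weight_measure integral_mkcond [leRHS]integral_mkcond.
have p0 (D : set V) x : 0 <= ((fun x => (w x)%:E) \_ D) x.
  by rewrite patchE; case: ifPn => // _; rewrite lee_fin.
have mp (D : set V) : measurable D -> measurable_fun [set: V] ((fun x => (w x)%:E) \_ D).
  by move=> mD; apply/(measurable_restrictT _ mD); exact: measurable_EFinw.
apply: ae_ge0_le_integral => //; [exact: mp|exact: mp|].
apply: filterS EF => x EF _; rewrite !patchE; case: ifPn => [/set_mem/EF Fx|_].
  by rewrite mem_set.
by case: ifPn => // _; rewrite lee_fin.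
Qed.

Lemma le_weight_measure E F : measurable E -> measurable F ->
  E `<=` F -> W E <= W F.
Proof. by move=> mE mF EF; apply: le_weight_measure_ae => //; exact: nearW. Qed.

Lemma weight_measureU E F : measurable E -> measurable F ->
  W (E `|` F) <= W E + W F.
Proof.
move=> mE mF; rewrite -(setDUK (@subsetUr _ E F)) /weight_measure.
have mD : measurable ((E `|` F) `\` F) by apply: measurableD => //; exact: measurableU.
rewrite ge0_integral_setU//.
- rewrite addeC leeD2r//; apply: le_weight_measure => //.
  by move=> x [[|]].
- exact: measurable_EFinw.
- by move=> x _; rewrite lee_fin.
- by rewrite disj_set2E setDIK.
Qed.

Lemma measurable_EFinwM (h : V -> \bar R) D : measurable_fun D h ->
  measurable_fun D (fun x => h x * (w x)%:E).
Proof. by move=> mh; apply: emeasurable_funM => //; exact: measurable_EFinw. Qed.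

End weights.

(** The [A1] condition over half-open cubes, which dyadic arguments need, with
averages multiplied out to stay with products. The bounds on the weights of cubes
make it possible to compute with them as positive reals. *)
Record A1_on_cubes (R : realType) (n : nat) (w : Rn R n -> R) (A : R) : Prop := {
  A1_ge0 : forall x, (0 <= w x)%R ;
  A1_measurable : measurable_fun [set: Rn R n] w ;
  A1_const_ge1 : (1 <= A)%R ;
  A1_unit_vol_gt0 : (0 < unit_vol R n)%R ;
  A1_fin : forall c s, weight_measure w (cube c s) < +oo ;
  A1_gt0 : forall c s, (0 < s)%R -> 0 < weight_measure w (cube c s) ;
  A1_ae : forall c s, (0 < s)%R -> {ae leb, forall y, cube c s y ->
    weight_measure w (cube c s) <= A%:E * leb (cube c s) * (w y)%:E } }.

Section A1_cubes.
Context {R : realType} {n : nat}.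
Notation V := (Rn R n).
Variables (w : V -> R) (A : R).
Hypothesis wA : A1_on_cubes w A.
Notation W := (weight_measure w).
Let w_ge0 := A1_ge0 wA.
Let mw := A1_measurable wA.
Let u0 := A1_unit_vol_gt0 wA.

Definition cubew (c : V) (s : R) : R := fine (W (cube c s)).

Lemma cubewE c s : W (cube c s) = (cubew c s)%:E.
Proof.
by rewrite /cubew fineK// ge0_fin_numE ?(A1_fin wA)//; exact: weight_measure_ge0.
Qed.

Lemma cubew_gt0 c s : (0 < s)%R -> (0 < cubew c s)%R.
Proof. by move=> s0; rewrite -lte_fin -cubewE (A1_gt0 wA). Qed.

Lemma A1_const_gt0 : (0 < A)%R.
Proof. by rewrite (lt_le_trans ltr01)// (A1_const_ge1 wA). Qed.

Lemma leb_cube_gt0 (c : V) s : (0 < s)%R -> (0 < s ^+ n * unit_vol R n)%R.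
Proof. by move=> s0; rewrite mulr_gt0// exprn_gt0. Qed.

(** Integrating the pointwise bound against [h]: averages for Lebesgue measure
are dominated by averages for the weight. *)
Lemma A1_integral c s (E : set V) (h : V -> \bar R) :
  (0 < s)%R -> measurable E -> E `<=` cube c s ->
  measurable_fun [set: V] h -> (forall x, 0 <= h x) ->
  (cubew c s)%:E * \int[leb]_(x in E) h x <=
  (A * (s ^+ n * unit_vol R n))%:E * \int[leb]_(x in E) (h x * (w x)%:E).
Proof.
move=> s0 mE EQ mh h0.
have mhE : measurable_fun E h by exact: measurable_funTS.
have k0 : (0 <= A * (s ^+ n * unit_vol R n))%R.
  by rewrite ltW// mulr_gt0 ?A1_const_gt0// leb_cube_gt0.
rewrite -ge0_integralZl//; last by rewrite lee_fin ltW// cubew_gt0.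
rewrite -ge0_integralZl//; last 2 first.
- exact: measurable_EFinwM.
- by move=> x _; rewrite mule_ge0// lee_fin.
apply: ae_ge0_le_integral; first exact: mE.
- by move=> x _; rewrite mule_ge0// lee_fin ltW// cubew_gt0.
- by apply: measurable_funeM; exact: mhE.
- by move=> x _; rewrite !mule_ge0// lee_fin.
- by apply: measurable_funeM; exact: measurable_EFinwM.
apply: filterS (A1_ae wA c s0) => x h1 /EQ/h1.
rewrite cubewE leb_cube// -EFinM => h2.
by rewrite muleC muleCA; apply: lee_wpmul2l.
Qed.

Lemma A1_subset c s (E : set V) : (0 < s)%R -> measurable E ->
  E `<=` cube c s ->
  (cubew c s)%:E * leb E <= (A * (s ^+ n * unit_vol R n))%:E * W E.
Proof.
move=> s0 mE EQ.
have := @A1_integral c s E (cst 1) s0 mE EQ (measurable_cst _) (fun _ => lee01).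
rewrite integral_cst// mul1e => /le_trans; apply.
by under eq_integral do rewrite mul1e.
Qed.

(** The doubling property, as the case of a subcube in [A1_subset]. *)
Lemma A1_doubling c s d t : (0 < s)%R -> (0 < t)%R ->
  cube d t `<=` cube c s -> (cubew c s * t ^+ n <= A * s ^+ n * cubew d t)%R.
Proof.
move=> s0 t0 sub; have := A1_subset s0 (measurable_cube d t) sub.
rewrite leb_cube// cubewE -!EFinM lee_fin => h.
by rewrite -(ler_pM2r u0); move: h; congr (_ <= _)%R; ring.
Qed.

Definition A1_ratio : R := (1 - (A *+ 2)^-1)%R.

Lemma A1_ratio_gt0 : (0 < A1_ratio)%R.
Proof.
have A1 := A1_const_ge1 wA; rewrite subr_gt0 invf_lt1 ?mulrn_wgt0 ?A1_const_gt0//.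
by rewrite mulr2n; lra.
Qed.

Lemma A1_ratio_lt1 : (A1_ratio < 1)%R.
Proof. by rewrite /A1_ratio ltrBlDr ltrDl invr_gt0 mulrn_wgt0// A1_const_gt0. Qed.

(** The complement of [E] fills at least half of the cube, hence by [A1_subset] it
carries at least the proportion [1 / (2 A)] of the weight. *)
Lemma A1_small c s (E : set V) : (0 < s)%R -> measurable E ->
  E `<=` cube c s -> leb E <= (s ^+ n * unit_vol R n / 2)%:E ->
  W E <= (A1_ratio * cubew c s)%:E.
Proof.
move=> s0 mE EQ half.
have Q0 := leb_cube_gt0 c s0; have W0 := cubew_gt0 c s0; have A0 := A1_const_gt0.
set q := (s ^+ n * unit_vol R n)%R in half Q0.
have mQ := measurable_cube c s.
have mD : measurable (cube c s `\` E) by exact: measurableD.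
have WED : (cubew c s)%:E = W E + W (cube c s `\` E).
  rewrite -cubewE -[X in W X](setDUK EQ) /weight_measure ge0_integral_setU//.
  - exact: measurable_EFinw.
  - by move=> x _; rewrite lee_fin.
  - by rewrite disj_set2E setDIK.
have lebD : q%:E = leb E + leb (cube c s `\` E).
  rewrite -(leb_cube c s0) -[X in leb X](setDUK EQ) measureU//.
  by rewrite setDIK.
have finE : W E \is a fin_num.
  rewrite ge0_fin_numE ?weight_measure_ge0//; apply: le_lt_trans (A1_fin wA c s).
  exact: le_weight_measure.
have finD : W (cube c s `\` E) \is a fin_num.
  rewrite ge0_fin_numE ?weight_measure_ge0//; apply: le_lt_trans (A1_fin wA c s).
  by apply: le_weight_measure => // x [].
have lfinE : leb E \is a fin_num.
  by rewrite ge0_fin_numE ?measure_ge0//; apply: le_lt_trans half _; rewrite ltry.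
have lfinD : leb (cube c s `\` E) \is a fin_num.
  rewrite ge0_fin_numE ?measure_ge0//; apply: (@le_lt_trans _ _ q%:E).
    by rewrite lebD leeDr// measure_ge0.
  by rewrite ltry.
have := A1_subset s0 mD (@subDsetl _ _ _).
move: half lebD WED; rewrite -/q -(fineK finE) -(fineK finD) -(fineK lfinE) -(fineK lfinD).
set we := fine (W E); set wd := fine (W (_ `\` _)).
set le := fine (leb E); set ld := fine (leb (_ `\` _)).
rewrite -!EFinD -!EFinM !lee_fin => half [lebD] [WED] h.
have h2 : (cubew c s * (q / 2) <= A * q * wd)%R.
  by apply: le_trans h; rewrite ler_pM2l//; lra.
have h3 : (cubew c s * (A *+ 2)^-1 <= wd)%R.
  rewrite ler_pdivrMr ?mulrn_wgt0// -(ler_pM2r Q0).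
  by rewrite mulr2n; nra.
by rewrite /A1_ratio mulrBl mul1r; nra.
Qed.

End A1_cubes.

(** * The John-Nirenberg inequality with an A1 weight *)

Lemma measurable_osc {R : realType} {n : nat} (b : Rn R n -> R) (t : R) :
  measurable_fun [set: Rn R n] b ->
  measurable_fun [set: Rn R n] (fun x => `|b x - t|%R).
Proof.
move=> mb; apply: measurableT_comp; first exact: normr_measurable.
by apply: measurable_funB; [exact: mb|exact: measurable_cst].
Qed.

Section john_nirenberg.
Context {R : realType} {n : nat}.
Notation V := (Rn R n).
Variables (w : V -> R) (A : R).
Hypothesis wA : A1_on_cubes w A.
Notation W := (weight_measure w).
Let w_ge0 := A1_ge0 wA.
Let mw := A1_measurable wA.
Let u0 := A1_unit_vol_gt0 wA.
Variables (b : V -> R) (a : V -> R -> R) (beta : R).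
Hypothesis mb : measurable_fun [set: V] b.
Hypothesis beta_gt0 : (0 < beta)%R.
Hypothesis mean_osc : forall c s, (0 < s)%R ->
  \int[leb]_(x in cube c s) (`|b x - a c s|%R)%:E <= beta%:E * leb (cube c s).

Let mosc (t : R) : measurable_fun [set: V] (fun x => `|b x - t|%R).
Proof. exact: measurable_osc. Qed.

(** Both [t] and [a c s] are close to [b] on average over the cube. *)
Lemma near_mean_le c s (t g : R) : (0 < s)%R ->
  \int[leb]_(x in cube c s) (`|b x - t|%R)%:E <= g%:E * leb (cube c s) ->
  (`|a c s - t| <= g + beta)%R.
Proof.
move=> s0 h; have q0 := leb_cube_gt0 wA c s0.
have mE r : measurable_fun (cube c s) (fun x => (`|b x - r|%R)%:E).
  by apply/measurable_EFinP; exact: measurable_funTS.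
have mQ := measurable_cube c s.
have : (`|a c s - t|)%:E * leb (cube c s) <= (g + beta)%:E * leb (cube c s).
  rewrite -integral_cst//.
  apply: (@le_trans _ _ (\int[leb]_(x in cube c s)
      ((`|b x - t|%R)%:E + (`|b x - a c s|%R)%:E))).
    apply: ge0_le_integral; first exact: mQ.
    - by move=> x _; rewrite lee_fin.
    - exact: measurable_cst.
    - by apply: emeasurable_funD; exact: mE.
    - move=> x _; rewrite -EFinD lee_fin.
      by rewrite [(`|b x - t| + _)%R]addrC -[(`|b x - a c s|)%R]normrN opprB; exact: ler_distD.
  rewrite ge0_integralD//; try by move=> x _; rewrite lee_fin.
  rewrite EFinD muleDl ?leb_cube//.
  by rewrite -(leb_cube c s0); apply: leeD => //; exact: mean_osc.
by rewrite leb_cube// -!EFinM lee_fin ler_pM2r.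
Qed.

(** The Calderon-Zygmund height is [beta *+ 2]; a selected cube has average
oscillation at most [2 ^ n] times that around the constant of the large cube,
and [beta] around its own. *)
Definition jn_step : R := (2 ^+ n * (beta *+ 2) + beta)%R.

Lemma jn_step_ge : (beta *+ 2 <= jn_step)%R.
Proof.
have : (1 <= 2 ^+ n :> R)%R by rewrite exprn_ege1// ler1n.
rewrite /jn_step; move: (2 ^+ n)%R => t t1.
have : (beta *+ 2 <= t * (beta *+ 2))%R by rewrite ler_peMl// mulrn_wge0// ltW.
by have := beta_gt0; lra.
Qed.

Lemma measurable_osc_gt c s (t r : R) :
  measurable (cube c s `&` [set x | (r < `|b x - t|)%R]).
Proof.
apply: measurableI; first exact: measurable_cube.
rewrite -[X in measurable X]setTI.
have -> : [set x | (r < `|b x - t|)%R] = (fun x => `|b x - t|%R) @^-1` `]r, +oo[.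
  by apply/seteqP; split => x /=; rewrite in_itv/= andbT.
exact: mosc.
Qed.

(** Weighted John-Nirenberg. On the complement of the Calderon-Zygmund cubes of
[|b - a|] at height [2 beta] the oscillation is at most [jn_step]; on each
selected cube the constant changes by at most [jn_step]; and the selected cubes
carry at most the proportion [A1_ratio A] of the weight. *)
Lemma weighted_john_nirenberg (k : nat) c s : (0 < s)%R ->
  W (cube c s `&` [set x | (k%:R * jn_step < `|b x - a c s|)%R]) <=
  (A1_ratio A ^+ k * cubew w c s)%:E.
Proof.
elim: k c s => [|k IH] c s s0.
  rewrite expr0 mul1r -(cubewE wA); apply: le_weight_measure => //.
  - exact: measurable_osc_gt.
  - exact: measurable_cube.
have b20 : (0 < beta *+ 2)%R by rewrite mulrn_wgt0.
have mQ := measurable_cube c s.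
have [||q [tU qP Uc Uae]] := calderon_zygmund (c := c) s0 b20 (mosc (a c s)).
- by [].
- apply: le_trans (mean_osc _ s0) _; rewrite leb_cube// -!EFinM lee_fin.
  by rewrite ler_pM2r ?(leb_cube_gt0 wA)// mulr2n lerDl ltW.
set U := (fun i => _) in tU Uc Uae.
pose E i := if q i is Some p then
  cube p.1 p.2 `&` [set x | (k%:R * jn_step < `|b x - a p.1 p.2|)%R] else set0.
have EU i : E i `<=` U i by rewrite /E /U; case: (q i) => [p x []|].
have mU i : measurable (U i).
  by rewrite /U; case: (q i) => [p|//]; exact: measurable_cube.
have mE i : measurable (E i).
  by rewrite /E; case: (q i) => [p|//]; exact: measurable_osc_gt.
have mUU : measurable (\bigcup_i U i) by exact: bigcupT_measurable.
have UQ : \bigcup_i U i `<=` cube c s.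
  by move=> x [i _]; rewrite /U; case qi: (q i) => [p|//]; have [_ + _] := qP _ _ qi; apply.
apply: (@le_trans _ _ (W (\bigcup_i E i))).
  apply: le_weight_measure_ae => //; [exact: measurable_osc_gt|exact: bigcupT_measurable|].
  apply: filterS Uae => x Ux [xQ big]; apply: contrapT => nE.
  have : (`|b x - a c s| <= beta *+ 2)%R.
    apply: Ux => // -[i _ Uix]; apply: nE; exists i => //.
    move: Uix; rewrite /E /U; case qi: (q i) => [p|//] xp; split => //=.
    have [p0 _ pl] := qP _ _ qi.
    have d := near_mean_le p0 pl.
    have := ler_distD (a p.1 p.2) (b x) (a c s).
    move: big; rewrite /= -natr1 mulrDl mul1r -/jn_step => big h.
    rewrite -/jn_step in d; lra.
  move=> h; have := jn_step_ge; move: big; rewrite /= -natr1 mulrDl mul1r.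
  have : (0 <= k%:R * jn_step)%R.
    by rewrite mulr_ge0//; apply: le_trans jn_step_ge; exact: ltW.
  by lra.
rewrite /weight_measure ge0_integral_bigcup//; last 3 first.
- exact: measurable_EFinw.
- by move=> x _; rewrite lee_fin.
- move=> i j _ _ [x [Ei Ej]]; apply: tU => //; exists x.
  by split; exact: EU.
apply: (@le_trans _ _ (\sum_(i <oo) (A1_ratio A ^+ k)%:E * W (U i))).
  apply: lee_nneseries => [i _ _|i _]; first exact: weight_measure_ge0.
  rewrite /E /U; case qi: (q i) => [p|]; last first.
    by rewrite integral_set0 /weight_measure integral_set0 mule0.
  have [p0 _ _] := qP _ _ qi.
  by rewrite (cubewE wA) -EFinM; exact: IH.
rewrite nneseriesZl; last by move=> i _; exact: weight_measure_ge0.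
rewrite exprSr -mulrA EFinM; apply: lee_wpmul2l.
  by rewrite lee_fin exprn_ge0// ltW// (A1_ratio_gt0 wA).
rewrite -ge0_integral_bigcup//; last 2 first.
- exact: measurable_EFinw.
- by move=> x _; rewrite lee_fin.
apply: (A1_small wA) => //.
have := le_trans Uc (mean_osc c s0); rewrite leb_cube// -EFinM.
rewrite -lee_pdivlMl// -EFinM => /le_trans; apply; rewrite lee_fin.
rewrite le_eqVlt; apply/orP; left; apply/eqP; rewrite mulr2n; field.
by rewrite gt_eqF// -mulr2n.
Qed.

End john_nirenberg.

(** * Geometric sums and the function Phi *)

Lemma geometric_eseries_le (R : realType) (k z : R) :
  (0 <= k)%R -> (0 < z < 1)%R ->
  \sum_(i <oo) (k * z ^+ i)%:E <= (k / (1 - z))%:E.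
Proof.
move=> k0 /andP[z0 z1]; apply: lime_le.
  by apply: is_cvg_nneseries => i _ _; rewrite lee_fin mulr_ge0// exprn_ge0// ltW.
apply: nearW => N; rewrite sumEFin lee_fin.
by apply: geometric_le_lim => //; rewrite ger0_norm// ltW.
Qed.

(** The [i.+1] terms of the geometric sum up to rank [i] are at least
[z ^+ i]. *)
Lemma linear_geometric_le (R : realType) (z : R) (i : nat) : (0 < z < 1)%R ->
  (i.+1%:R * z ^+ i <= (1 - z)^-1)%R.
Proof.
move=> /andP[z0 z1].
apply: (@le_trans _ _ (series (geometric 1 z) i.+1)).
  rewrite seriesEord/= mulr_natl -[X in (_ *+ X <= _)%R](card_ord i.+1) -sumr_const.
  apply: ler_sum => j _; rewrite mul1r ler_wiXn2l ?ltW//.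
  by rewrite -ltnS ltn_ord.
by rewrite -[leRHS]mul1r; apply: geometric_le_lim => //; rewrite ger0_norm// ltW.
Qed.

Section Phi.
Context {R : realType}.
Implicit Types t u s l : R.

Lemma Phi_ge t : (0 <= t)%R -> (t <= Phi t)%R.
Proof. by move=> t0; rewrite /Phi ler_peMr// lerDl le_max lexx orbT. Qed.

Lemma Phi_ge0 t : (0 <= t)%R -> (0 <= Phi t)%R.
Proof. by move=> t0; exact: le_trans t0 (Phi_ge t0). Qed.

Lemma Phi_double t : (0 <= t)%R -> (Phi (t * 2) <= 4 * Phi t)%R.
Proof.
rewrite le_eqVlt => /predU1P[<-|t0]; first by rewrite mul0r /Phi !mul0r mulr0.
have ln2 : (ln 2 <= 1 :> R)%R.
  by rewrite -[leRHS]expRK ler_ln ?posrE ?expR_gt0//; have := expR_ge1Dx (1 : R); lra.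
rewrite /Phi lnM ?posrE//.
have : (Num.max (ln t + ln 2) 0 <= 1 + Num.max (ln t) 0)%R.
  by case: (leP 0 (ln t))%R => ?; case: (leP 0 (ln t + ln 2))%R => ?; lra.
have : (0 <= Num.max (ln t) 0)%R by rewrite le_max lexx orbT.
move: (Num.max (ln t) 0)%R (Num.max (ln t + ln 2) 0)%R => p q p0 qp.
have : (0 <= t * (1 + p - q))%R by rewrite mulr_ge0//; lra.
have : (0 <= t * p)%R by rewrite mulr_ge0// ltW.
by lra.
Qed.

Lemma measurable_Phi : measurable_fun [set: R] (@Phi R).
Proof.
apply: measurable_funM => //; apply: measurable_funD => //.
by apply: measurable_maxr => //; exact: measurable_ln.
Qed.

(** Young's inequality between [t log t] and the exponential, with a parameter
[l] that makes the exponential term small at a logarithmic price. If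
[s <= l * expR (u / 2)], the first term suffices; otherwise
[u / 2 <= ln s - ln l]. *)
Lemma Phi_young u s l : (0 <= u)%R -> (0 <= s)%R -> (0 < l <= 1)%R ->
  (u * s <= 2 * l * expR u + 2 * (1 - ln l) * Phi s)%R.
Proof.
move=> u0 s0 /andP[l0 l1].
have L0 : (0 <= - ln l)%R by rewrite oppr_ge0 ln_le0.
have P0 := Phi_ge0 s0.
have E : (expR u = expR (u / 2) * expR (u / 2))%R.
  by rewrite -expRD; congr expR; field.
have e2 : (u / 2 <= expR (u / 2))%R by have := expR_ge1Dx (u / 2)%R; lra.
have e0 := expR_gt0 (u / 2)%R.
have [sl|ls] := leP s (l * expR (u / 2))%R.
  apply: (@le_trans _ _ (2 * l * expR u)%R); last first.
    by rewrite lerDl mulr_ge0// mulr_ge0//; lra.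
  rewrite E; apply: (@le_trans _ _ (u * (l * expR (u / 2)))%R); first by rewrite ler_wpM2l.
  have : (u * (l * expR (u / 2)) <= (2 * expR (u / 2)) * (l * expR (u / 2)))%R.
    by apply: ler_wpM2r; [apply: mulr_ge0; exact: ltW|lra].
  by lra.
have sgt0 : (0 < s)%R by apply: lt_trans ls; rewrite mulr_gt0.
apply: (@le_trans _ _ (2 * (1 - ln l) * Phi s)%R); last first.
  by rewrite lerDr; apply: mulr_ge0; [lra|exact: expR_ge0].
have h : (u / 2 <= ln s - ln l)%R.
  rewrite -[leLHS]expRK lerBrDr -lnM ?posrE ?expR_gt0// ler_ln ?posrE ?mulr_gt0 ?expR_gt0//.
  by rewrite mulrC ltW.
have m0 : (ln s <= Num.max (ln s) 0)%R by rewrite le_max lexx.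
have m1 : (0 <= Num.max (ln s) 0)%R by rewrite le_max lexx orbT.
rewrite /Phi; move: (Num.max _ _) m0 m1 h => p m0 m1 h.
have h2 : (u <= 2 * ((1 - ln l) * (1 + p)))%R.
  have : (0 <= - ln l * p)%R by rewrite mulr_ge0.
  by lra.
apply: (@le_trans _ _ (2 * ((1 - ln l) * (1 + p)) * s)%R).
  by rewrite ler_wpM2r.
by rewrite le_eqVlt; apply/orP; left; apply/eqP; ring.
Qed.

End Phi.

(** * Exponential integrability of functions of bounded mean oscillation *)

Section exponential_integrability.
Context {R : realType} {n : nat}.
Notation V := (Rn R n).
Variables (w : V -> R) (A : R).
Hypothesis wA : A1_on_cubes w A.
Notation W := (weight_measure w).
Let w_ge0 := A1_ge0 wA.
Let mw := A1_measurable wA.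
Variables (b : V -> R) (a : V -> R -> R) (beta : R).
Hypothesis mb : measurable_fun [set: V] b.
Hypothesis beta_gt0 : (0 < beta)%R.
Hypothesis mean_osc : forall c s, (0 < s)%R ->
  \int[leb]_(x in cube c s) (`|b x - a c s|%R)%:E <= beta%:E * leb (cube c s).

Let M := @jn_step R n beta.
Let th := A1_ratio A.

Let M_gt0 : (0 < M)%R.
Proof. by apply: lt_le_trans (@jn_step_ge R n beta beta_gt0); rewrite mulrn_wgt0. Qed.

(** Larger than 1, but such that [exp_base * A1_ratio A < 1], so that the
layers of the John-Nirenberg inequality have a convergent sum. *)
Definition exp_base : R := (2 / (1 + th))%R.
Definition exp_rate : R := (ln exp_base / M)%R.
Definition exp_const : R :=
  (exp_base + exp_base ^+ 2 / (1 - exp_base * th))%R.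

Let th01 : (0 < th)%R * (th < 1)%R.
Proof. by split; [exact: (A1_ratio_gt0 wA)|exact: (A1_ratio_lt1 wA)]. Qed.

Lemma exp_base_gt1 : (1 < exp_base)%R.
Proof. by have [t0 t1] := th01; rewrite /exp_base ltr_pdivlMr; lra. Qed.

Lemma exp_base_ratio : (0 < exp_base * th < 1)%R.
Proof.
have [t0 t1] := th01; have := exp_base_gt1 => r1.
rewrite mulr_gt0//=; last by lra.
by rewrite /exp_base mulrAC ltr_pdivrMr; lra.
Qed.

Lemma exp_rate_gt0 : (0 < exp_rate)%R.
Proof. by rewrite divr_gt0// ln_gt0// exp_base_gt1. Qed.

Lemma exp_const_gt0 : (0 < exp_const)%R.
Proof.
have := exp_base_gt1; have /andP[_ h] := exp_base_ratio => r1.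
by rewrite addr_gt0//; [lra|rewrite divr_gt0 ?exprn_gt0//; lra].
Qed.

Let mosc (t : R) : measurable_fun [set: V] (fun x => `|b x - t|%R).
Proof. exact: measurable_osc. Qed.

Lemma measurable_exp_osc (t : R) :
  measurable_fun [set: V] (fun x => expR (exp_rate * `|b x - t|)%R).
Proof.
apply: measurableT_comp; first exact: measurable_expR.
exact: measurable_funM.
Qed.

(** If [k * M <= u < k.+1 * M], then [expR (exp_rate * u)] is at most
[exp_base ^+ k.+1]. For [k > 0] the strict inequality of the layer [k - 1]
holds, whence the shift of two in the exponent; the case [k = 0] is left to the
constant. *)
Lemma expR_layers (u : R) : (0 <= u)%R ->
  (expR (exp_rate * u)%R)%:E <= exp_base%:E +
    \sum_(k <oo) ((exp_base ^+ k.+2)%:E *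
      (if (k%:R * M < u)%R then 1 else 0)).
Proof.
move=> u0; have r1 := exp_base_gt1; pose k := Num.truncn (u / M)%R.
have r0 : (0 < exp_base)%R by apply: lt_trans r1.
have uM0 : (0 <= u / M)%R by rewrite divr_ge0// ltW.
have /andP[lo hi] := truncn_itv uM0; rewrite -/k in lo hi.
have le : (expR (exp_rate * u) <= exp_base ^+ k.+1)%R.
  rewrite -[X in (_ <= X ^+ _)%R]lnK ?posrE// -expRM_natl ler_expR.
  rewrite mulrC [leRHS]mulrC /exp_rate mulrA ler_pdivrMr// mulrC.
  rewrite -[leRHS]mulrA; apply: ler_wpM2l; first by rewrite ln_ge0// ltW.
  by rewrite -ler_pdivrMr// ltW.
have t0 i : 0 <= (exp_base ^+ i.+2)%:E * (if (i%:R * M < u)%R then 1 else 0 : \bar R).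
  by apply: mule_ge0; [rewrite lee_fin exprn_ge0// ltW|case: ifP].
case: k lo le {hi} => [|k] lo le.
  apply: le_trans (leeDl _ _); first by rewrite lee_fin.
  by apply: nneseries_ge0 => i _ _.
apply: le_trans (leeDr _ _); last by rewrite lee_fin ltW.
apply: le_trans (nneseries_lim_ge k.+1 _); last by move=> i _ _.
rewrite big_nat_recr//= ifT; last first.
  rewrite -ltr_pdivlMr//; apply: lt_le_trans lo.
  by rewrite ltr_nat.
rewrite mule1; apply: le_trans (leeDr _ _); first by rewrite lee_fin.
by apply: sume_ge0 => i _.
Qed.

Lemma exp_integrable c s : (0 < s)%R ->
  \int[leb]_(x in cube c s) (expR (exp_rate * `|b x - a c s|) * w x)%R%:E <=
  (exp_const * cubew w c s)%:E.
Proof.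
move=> s0; have mQ := measurable_cube c s.
have [t0 t1] := th01; have r1 := exp_base_gt1.
have r0 : (0 < exp_base)%R by apply: lt_trans r1.
pose S k := [set x | (k%:R * M < `|b x - a c s|)%R].
pose f k (x : V) := (exp_base ^+ k.+2)%:E * ((EFin \o w) \_ (S k)) x.
have mS k : measurable (S k).
  rewrite -[X in measurable X]setTI.
  rewrite (_ : S k = (fun x => `|b x - a c s|%R) @^-1` `](k%:R * M)%R, +oo[%classic).
    exact: mosc.
  by apply/seteqP; split => x /=; rewrite /S/= in_itv/= andbT.
have p0 k x : 0 <= ((EFin \o w) \_ (S k)) x.
  by rewrite patchE; case: ifPn => //= _; rewrite lee_fin.
have mp k : measurable_fun [set: V] ((EFin \o w) \_ (S k)).
  by apply/(measurable_restrictT _ (mS k)); exact: measurable_EFinw.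
have f0 k x : 0 <= f k x by rewrite mule_ge0// lee_fin exprn_ge0// ltW.
have mf k : measurable_fun (cube c s) (f k).
  by apply: measurable_funeM; exact: measurable_funTS.
have mbw : measurable_fun (cube c s) (fun x => exp_base%:E * (w x)%:E).
  by apply: measurable_funeM; exact: measurable_EFinw.
have msum : measurable_fun (cube c s) (fun x => \sum_(k <oo) f k x).
  by apply: ge0_emeasurable_sum => // k x _ _.
have bw0 x : cube c s x -> 0 <= exp_base%:E * (w x)%:E.
  by move=> _; rewrite mule_ge0// lee_fin// ltW.
have sum0 x : cube c s x -> 0 <= \sum_(k <oo) f k x.
  by move=> _; apply: nneseries_ge0 => k _ _.
apply: (@le_trans _ _ (\int[leb]_(x in cube c s)
    (exp_base%:E * (w x)%:E + \sum_(k <oo) f k x))).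
  apply: ge0_le_integral; first exact: mQ.
  - by move=> x _; rewrite lee_fin mulr_ge0// expR_ge0.
  - apply/measurable_EFinP; apply: measurable_funTS.
    by apply: measurable_funM; [exact: measurable_exp_osc|exact: mw].
  - by apply: emeasurable_funD; [exact: mbw|exact: msum].
  - move=> x _; rewrite EFinM.
    apply: (@le_trans _ _ ((exp_base%:E + \sum_(k <oo) ((exp_base ^+ k.+2)%:E *
        (if (k%:R * M < `|b x - a c s|)%R then 1 else 0))) * (w x)%:E)).
      by apply: lee_wpmul2r; [rewrite lee_fin|exact: expR_layers].
    have g0 k : 0 <= (exp_base ^+ k.+2)%:E *
        (if (k%:R * M < `|b x - a c s|)%R then 1 else 0 : \bar R).
      by apply: mule_ge0; [rewrite lee_fin exprn_ge0// ltW|case: ifP].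
    rewrite ge0_muleDl//; last 2 first.
    + by rewrite lee_fin ltW.
    + by apply: nneseries_ge0 => k _ _.
    rewrite leeD2l// muleC -nneseriesZl//.
    apply: lee_nneseries => [k _ _|k _]; first by rewrite mule_ge0// lee_fin.
    rewrite /f patchE muleC -muleA; apply: lee_wpmul2l.
      by rewrite lee_fin exprn_ge0// ltW.
    case: ifPn => h.
      by rewrite mul1e ifT// inE.
    by rewrite mul0e; case: ifP => //= _; rewrite lee_fin.
rewrite (ge0_integralD leb mQ bw0 mbw sum0 msum).
rewrite /exp_const mulrDl EFinD; apply: leeD.
  rewrite ge0_integralZl//; last 3 first.
  - exact: measurable_EFinw.
  - by move=> x _; rewrite lee_fin.
  - by rewrite lee_fin ltW.
  by rewrite -/(W (cube c s)) (cubewE wA).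
rewrite integral_nneseries//.
apply: (@le_trans _ _ (\sum_(k <oo)
    (exp_base ^+ 2 * cubew w c s * (exp_base * th) ^+ k)%:E)).
  apply: lee_nneseries => [k _ _|k _]; first exact: integral_ge0.
  rewrite /f ge0_integralZl//; last 2 first.
  - exact: measurable_funTS.
  - by rewrite lee_fin exprn_ge0// ltW.
  rewrite -integral_mkcondr -/(W _).
  have := weighted_john_nirenberg wA mb beta_gt0 mean_osc k c s0.
  rewrite -/M -/th => h.
  have -> : (exp_base ^+ 2 * cubew w c s * (exp_base * th) ^+ k =
      exp_base ^+ k.+2 * (th ^+ k * cubew w c s))%R.
    rewrite [((exp_base * th) ^+ k)%R]exprMn [(exp_base ^+ k.+2)%R]exprS.
    by rewrite [(exp_base ^+ k.+1)%R]exprS; ring.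
  by rewrite [leRHS]EFinM; apply: lee_wpmul2l; rewrite ?lee_fin ?exprn_ge0// ltW.
apply: le_trans (geometric_eseries_le _ exp_base_ratio) _.
  by rewrite mulr_ge0 ?exprn_ge0 ?ltW// (cubew_gt0 wA).
by rewrite lee_fin mulrAC.
Qed.

End exponential_integrability.

(** * Sums over doubled cubes *)

Lemma powR_ratio (R : realType) (x kappa : R) : (0 < x)%R ->
  (x^-1 * x `^ kappa = (x `^ (1 - kappa))^-1)%R.
Proof.
move=> x0; have p0 : (x `^ (1 - kappa) != 0)%R by rewrite gt_eqF// powR_gt0.
apply: (mulIf p0); rewrite mulVf// -mulrA -powRD; last by rewrite (gt_eqF x0) implybT.
by rewrite addrC subrK powRr1 ?ltW// mulVf// gt_eqF.
Qed.

Lemma powR_ratio_le (R : realType) (x y z kappa : R) (i : nat) :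
  (0 < x)%R -> (0 < y)%R -> (0 < z)%R -> (kappa < 1)%R ->
  (x <= z ^+ i * y)%R ->
  (y^-1 * y `^ kappa <= x^-1 * x `^ kappa * (z `^ (1 - kappa)) ^+ i)%R.
Proof.
move=> x0 y0 z0 k1 xy; rewrite !powR_ratio//.
have h : (x `^ (1 - kappa) <= (z `^ (1 - kappa)) ^+ i * y `^ (1 - kappa))%R.
  have -> : ((z `^ (1 - kappa)) ^+ i = (z ^+ i) `^ (1 - kappa))%R.
    by rewrite -(powR_mulrn i (powR_ge0 z _)) -powRrM mulrC powRrM powR_mulrn// ltW.
  have zi0 : (0 <= z ^+ i)%R by rewrite exprn_ge0// ltW.
  rewrite -(powRM _ zi0 (ltW y0)).
  by apply: ge0_ler_powR; rewrite ?nnegrE ?subr_ge0 ?mulr_ge0//; exact: ltW.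
by rewrite mulrC ler_pdivlMr ?powR_gt0// mulrC ler_pdivrMr ?powR_gt0.
Qed.

Section tails.
Context {R : realType} {n : nat}.
Notation V := (Rn R n).
Hypothesis n_gt0 : (0 < n)%N.
Variables (w : V -> R) (A : R).
Hypothesis wA : A1_on_cubes w A.
Notation W := (weight_measure w).
Let w_ge0 := A1_ge0 wA.
Let mw := A1_measurable wA.
Variables (b : V -> R) (a : V -> R -> R) (beta : R).
Hypothesis mb : measurable_fun [set: V] b.
Hypothesis beta_gt0 : (0 < beta)%R.
Hypothesis mean_osc : forall c s, (0 < s)%R ->
  \int[leb]_(x in cube c s) (`|b x - a c s|%R)%:E <= beta%:E * leb (cube c s).
Variable kappa : R.
Hypothesis kappa_lt1 : (kappa < 1)%R.

Let M := @jn_step R n beta.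
Let th := A1_ratio A.
Let base := exp_base A.
Let rate := @exp_rate R n A beta.
Let K := exp_const A.

Definition ccubew (x : V) (h : R) : R := cubew w (x - const_mx h)%R (h *+ 2).
Definition amean (x : V) (h : R) : R := a (x - const_mx h)%R (h *+ 2).

Lemma ccubewE x h : W (ccube x h) = (ccubew x h)%:E.
Proof. exact: (cubewE wA). Qed.

Lemma ccubew_gt0 x h : (0 < h)%R -> (0 < ccubew x h)%R.
Proof. by move=> h0; apply: (cubew_gt0 wA); rewrite mulrn_wgt0. Qed.

(** A cube fills at most half of its double, so [A1_small] applies; this is
the reverse doubling property. *)
Lemma ccubew_double x h : (0 < h)%R -> (ccubew x h <= th * ccubew x (2 * h))%R.
Proof.
move=> h0; rewrite -lee_fin -ccubewE; apply: (A1_small wA) => //.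
- by rewrite mulrn_wgt0// mulr_gt0.
- exact: measurable_ccube.
- by apply: ccube_sub; rewrite mulr2n mulrDl mul1r lerDl ltW.
rewrite leb_ccube// lee_fin -mulrnAr exprMn.
have h2 : (0 <= (h *+ 2) ^+ n * unit_vol R n)%R.
  by rewrite mulr_ge0 ?exprn_ge0 ?unit_vol_ge0// mulrn_wge0// ltW.
have : (2 * ((h *+ 2) ^+ n * unit_vol R n) <=
    2 ^+ n * ((h *+ 2) ^+ n * unit_vol R n))%R.
  apply: ler_wpM2r => //.
  by rewrite -[X in (X <= _)%R]expr1 ler_weXn2l// ler1n.
move: (2 ^+ n)%R ((h *+ 2) ^+ n)%R => p q; lra.
Qed.

Lemma ccubew_growth x h i : (0 < h)%R ->
  (ccubew x h <= th ^+ i * ccubew x (2 ^+ i * h))%R.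
Proof.
move=> h0; elim: i => [|i IH]; first by rewrite !expr0 !mul1r.
apply: (le_trans IH); rewrite [(th ^+ i.+1)%R]exprSr -[leRHS]mulrA; apply: ler_wpM2l.
  by rewrite exprn_ge0// ltW// (A1_ratio_gt0 wA).
by rewrite [(2 ^+ i.+1)%R]exprS -mulrA; apply: ccubew_double; rewrite mulr_gt0// exprn_gt0.
Qed.

Let mosc (t : R) : measurable_fun [set: V] (fun x => `|b x - t|%R).
Proof. exact: measurable_osc. Qed.

Lemma amean_double x h : (0 < h)%R -> (`|amean x h - amean x (2 * h)| <= M)%R.
Proof.
move=> h0; have h20 : (0 < h *+ 2)%R by rewrite mulrn_wgt0.
have H0 : (0 < (2 * h) *+ 2)%R by rewrite mulrn_wgt0// mulr_gt0.
apply: (@le_trans _ _ (2 ^+ n * beta + beta)%R); last first.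
  by rewrite /M /jn_step lerD2r ler_wpM2l ?exprn_ge0// mulr2n lerDl ltW.
apply: (near_mean_le wA mb mean_osc h20).
apply: (@le_trans _ _ (\int[leb]_(y in ccube x (2 * h)) (`|b y - amean x (2 * h)|)%:E)).
  apply: ge0_subset_integral; try exact: measurable_cube.
  - by apply/measurable_EFinP; exact: measurable_funTS.
  - by move=> y _; rewrite lee_fin.
  - by apply: ccube_sub; rewrite mulr2n mulrDl mul1r lerDl ltW.
apply: (le_trans (mean_osc _ H0)); rewrite !leb_cube// -!EFinM lee_fin.
by rewrite -mulrnAr exprMn le_eqVlt; apply/orP; left; apply/eqP; ring.
Qed.

Lemma amean_drift x h i : (0 < h)%R ->
  (`|amean x (2 ^+ i * h) - amean x h| <= i%:R * M)%R.
Proof.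
move=> h0; elim: i => [|i IH]; first by rewrite expr0 mul1r subrr normr0 mul0r.
apply: le_trans (ler_distD (amean x (2 ^+ i * h)) _ _) _.
rewrite -[(i.+1%:R)%R]natr1 mulrDl mul1r addrC lerD// distrC exprS -mulrA.
by apply: amean_double; rewrite mulr_gt0// exprn_gt0.
Qed.

Lemma rateM : expR (rate * M)%R = base.
Proof.
have M0 : M != 0%R.
  rewrite gt_eqF//; apply: lt_le_trans (@jn_step_ge R n beta beta_gt0).
  by rewrite mulrn_wgt0.
rewrite /rate /exp_rate -/M divfK// lnK// posrE.
by apply: lt_trans (exp_base_gt1 wA).
Qed.

Let rate0 : (0 < rate)%R := exp_rate_gt0 wA beta_gt0.
Let base1 : (1 < base)%R := exp_base_gt1 wA.
Let base0 : (0 < base)%R := lt_trans ltr01 base1.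

(** The constants of successive doubled cubes differ by at most [M], which costs
a factor [expR (rate * M) = base] at each step. *)
Lemma exp_integrable_far x h i : (0 < h)%R ->
  \int[leb]_(y in ccube x (2 ^+ i * h))
     (expR (rate * `|b y - amean x h|) * w y)%R%:E <=
  (base ^+ i * K * ccubew x (2 ^+ i * h))%:E.
Proof.
move=> h0; have hi : (0 < 2 ^+ i * h)%R by rewrite mulr_gt0// exprn_gt0.
have hi2 : (0 < (2 ^+ i * h) *+ 2)%R by rewrite mulrn_wgt0.
have mQ := measurable_ccube x (2 ^+ i * h)%R.
have me t : measurable_fun (ccube x (2 ^+ i * h)%R)
    (fun y => (expR (rate * `|b y - t|) * w y)%R%:E).
  apply/measurable_EFinP; apply: measurable_funTS.
  by apply: measurable_funM; [exact: measurable_exp_osc|exact: mw].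
have e0 t y : 0 <= (expR (rate * `|b y - t|) * w y)%R%:E.
  by rewrite lee_fin mulr_ge0// expR_ge0.
apply: (@le_trans _ _ (\int[leb]_(y in ccube x (2 ^+ i * h))
    ((base ^+ i)%:E * (expR (rate * `|b y - amean x (2 ^+ i * h)|) * w y)%R%:E))).
  apply: ge0_le_integral; first exact: mQ.
  - by move=> y _; exact: e0.
  - exact: me.
  - by apply: measurable_funeM; exact: me.
  move=> y _; rewrite -EFinM lee_fin mulrA ler_wpM2r//.
  rewrite -rateM -expRM_natl -expRD ler_expR mulrCA -mulrDr ler_pM2l//.
  apply: le_trans (ler_distD (amean x (2 ^+ i * h)) _ _) _.
  by rewrite addrC lerD2r amean_drift.
rewrite ge0_integralZl//; last by rewrite lee_fin exprn_ge0// ltW.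
rewrite -mulrA EFinM; apply: lee_wpmul2l; first by rewrite lee_fin exprn_ge0// ltW.
exact: (exp_integrable wA mb beta_gt0 mean_osc).
Qed.


(** The square of [tail_ratio] is the decay of [w(Q) ^ (kappa - 1)] along
doubled cubes [Q]; the square root is kept to absorb a linear factor. *)
Definition tail_ratio : R := (th `^ ((1 - kappa) / 2))%R.

Lemma tail_ratio01 : (0 < tail_ratio < 1)%R.
Proof.
have t0 := A1_ratio_gt0 wA; have t1 := A1_ratio_lt1 wA.
rewrite powR_gt0//=.
have p0 : (0 < (1 - kappa) / 2)%R by rewrite divr_gt0// subr_gt0.
have -> : (1 = 1 `^ ((1 - kappa) / 2) :> R)%R by rewrite powR1.
by apply: (gt0_ltr_powR p0); rewrite ?nnegrE//; exact: ltW.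
Qed.

Lemma tail_ratio_sqr : (th `^ (1 - kappa) = tail_ratio ^+ 2)%R.
Proof. by rewrite -powR_mulrn ?powR_ge0// -powRrM divfK. Qed.

(** The power [kappa - 1] of the weight of a cube. *)
Definition weight_decay x h : R := ((ccubew x h)^-1 * ccubew x h `^ kappa)%R.

Lemma weight_decay_ge0 x h : (0 < h)%R -> (0 <= weight_decay x h)%R.
Proof. by move=> h0; rewrite mulr_ge0 ?powR_ge0// invr_ge0 ltW// ccubew_gt0. Qed.

Lemma weight_decay_le x h i : (0 < h)%R ->
  (weight_decay x (2 ^+ i * h) <= weight_decay x h * tail_ratio ^+ i * tail_ratio ^+ i)%R.
Proof.
move=> h0; rewrite -mulrA -exprD addnn -mul2n exprM -tail_ratio_sqr.
apply: powR_ratio_le => //; try exact: ccubew_gt0.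
- by apply: ccubew_gt0; rewrite mulr_gt0// exprn_gt0.
- exact: A1_ratio_gt0 wA.
- exact: ccubew_growth.
Qed.

Section fixed_function.
Variables (x : V) (h S : R) (g : V -> R).
Hypotheses (h_gt0 : (0 < h)%R) (S_ge0 : (0 <= S)%R).
Hypothesis mg : measurable_fun [set: V] g.
Hypothesis g_ge0 : forall y, (0 <= g y)%R.
Notation Q i := (ccube x (2 ^+ i * h)%R).
Hypothesis morrey : forall i,
  \int[leb]_(y in Q i) (Phi (g y) * w y)%R%:E <=
    (S * ccubew x (2 ^+ i * h) `^ kappa)%:E.

Let hi0 i : (0 < 2 ^+ i * h)%R.
Proof. by rewrite mulr_gt0// exprn_gt0. Qed.

Let mQ i : measurable (Q i). Proof. exact: measurable_ccube. Qed.

Let mPhig : measurable_fun [set: V] (fun y => Phi (g y) * w y)%R.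
Proof.
apply: measurable_funM; last exact: mw.
by apply: measurableT_comp; [exact: measurable_Phi|exact: mg].
Qed.

Lemma tail_linear :
  \sum_(i <oo) ((ccubew x (2 ^+ i * h))^-1%:E *
      \int[leb]_(y in Q i) (g y * w y)%R%:E) <=
  (S * weight_decay x h / (1 - tail_ratio))%:E.
Proof.
have /andP[t0 t1] := tail_ratio01.
apply: (@le_trans _ _ (\sum_(i <oo) (S * weight_decay x h * tail_ratio ^+ i)%:E)).
  apply: lee_nneseries => [i _ _|i _].
    rewrite mule_ge0 ?lee_fin ?invr_ge0 ?(ltW (ccubew_gt0 _ _))//.
    by apply: integral_ge0 => y _; rewrite lee_fin mulr_ge0.
  apply: (@le_trans _ _ ((ccubew x (2 ^+ i * h))^-1%:E *
      (S * ccubew x (2 ^+ i * h) `^ kappa)%:E)).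
    apply: lee_wpmul2l; first by rewrite lee_fin invr_ge0 ltW// ccubew_gt0.
    apply: le_trans (morrey i); apply: ge0_le_integral; first exact: mQ.
    - by move=> y _; rewrite lee_fin mulr_ge0.
    - apply/measurable_EFinP; apply: measurable_funTS.
      by apply: measurable_funM; [exact: mg|exact: mw].
    - by apply/measurable_EFinP; apply: measurable_funTS; exact: mPhig.
    - by move=> y _; rewrite lee_fin ler_wpM2r// Phi_ge.
  rewrite -EFinM lee_fin mulrCA -mulrA ler_wpM2l//.
  apply: le_trans (weight_decay_le x i h_gt0) _.
  have ti0 : (0 <= tail_ratio ^+ i)%R by rewrite exprn_ge0// ltW.
  apply: ler_piMr; first by rewrite mulr_ge0// weight_decay_ge0.
  by apply: exprn_ile1; exact: ltW.
apply: geometric_eseries_le; rewrite ?t0//.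
by rewrite mulr_ge0// weight_decay_ge0.
Qed.

(** Young's inequality is applied on [Q i] with the parameter
[d * (2 * base) ^- i]: the exponential terms, which grow like [base ^+ i], then
sum to a multiple of [d], and the logarithm of the parameter is linear in
[i]. *)
Lemma tail_log (d : R) : (0 < d <= 1)%R ->
  \sum_(i <oo) ((ccubew x (2 ^+ i * h))^-1%:E *
      \int[leb]_(y in Q i) (`|b y - amean x h| * g y * w y)%R%:E) <=
  (4 * rate^-1 * K * d +
   2 * rate^-1 * (1 - ln d + ln (2 * base)) / (1 - tail_ratio) ^+ 2 *
     (S * weight_decay x h))%:E.
Proof.
move=> /andP[d0 d1]; have /andP[t0 t1] := tail_ratio01.
have K0 : (0 < K)%R := exp_const_gt0 wA.
have ri0 : (0 <= rate^-1)%R by rewrite invr_ge0 ltW.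
pose L := (1 - ln d + ln (2 * base))%R.
have lnd : (0 <= - ln d)%R by rewrite oppr_ge0 ln_le0.
have b1 := base1; have lnb : (0 <= ln (2 * base))%R by apply: ln_ge0; lra.
pose lam i := (d * (2 * base) ^- i)%R.
have b2 : (0 < 2 * base)%R by rewrite mulr_gt0.
have lam01 i : (0 < lam i <= 1)%R.
  have p0 : (0 < (2 * base) ^+ i)%R by rewrite exprn_gt0.
  have p1 : (1 <= (2 * base) ^+ i)%R by apply: exprn_ege1; lra.
  have q0 : (0 < (2 * base) ^- i)%R by rewrite invr_gt0.
  have q1 : ((2 * base) ^- i <= 1)%R by rewrite invf_le1.
  by rewrite /lam mulr_gt0//=; apply: mulr_ile1 => //; exact: ltW.
have lnlam i : (1 - ln (lam i) <= L * i.+1%:R)%R.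
  rewrite /lam lnM ?posrE ?invr_gt0 ?exprn_gt0// lnV ?posrE ?exprn_gt0// lnXn//.
  have i0 : (0 <= i%:R :> R)%R by rewrite ler0n.
  rewrite -[(ln (2 * base) *+ i)%R]mulr_natl -[(i.+1%:R)%R]natr1 /L.
  have := mulr_ge0 i0 lnd; move: (ln d) (ln (2 * base))%R (i%:R)%R lnd lnb i0.
  by move=> p q z *; lra.
pose al : R := (2 * rate^-1 * K * d)%R.
pose be : R := (2 * rate^-1 * L / (1 - tail_ratio) * (S * weight_decay x h))%R.
have al0 : (0 <= al)%R by rewrite !mulr_ge0// ltW.
have be0 : (0 <= be)%R.
  have wd0 := weight_decay_ge0 x h_gt0.
  have it0 : (0 <= (1 - tail_ratio)^-1)%R by rewrite invr_ge0; lra.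
  have L0 : (0 <= L)%R by rewrite /L; lra.
  rewrite /be; move: (weight_decay x h) wd0 => wd wd0.
  by move: (L) L0 => L' L0; rewrite !mulr_ge0.
apply: (@le_trans _ _ (\sum_(i <oo) ((al * 2^-1 ^+ i)%:E + (be * tail_ratio ^+ i)%:E))).
  apply: lee_nneseries => [i _ _|i _].
    rewrite mule_ge0 ?lee_fin ?invr_ge0 ?(ltW (ccubew_gt0 _ _))//.
    by apply: integral_ge0 => y _; rewrite lee_fin !mulr_ge0.
  have /andP[l0 l1] := lam01 i.
  have L1 : (0 <= 1 - ln (lam i))%R by have := ln_le0 l1; lra.
  set Wi := ccubew x (2 ^+ i * h).
  have W0 : (0 < Wi)%R by exact: ccubew_gt0.
  apply: (@le_trans _ _ (Wi^-1%:E * ((2 * rate^-1 * lam i * (base ^+ i * K * Wi))%:E +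
      (2 * rate^-1 * (1 - ln (lam i)) * (S * Wi `^ kappa))%:E))).
    apply: lee_wpmul2l; first by rewrite lee_fin invr_ge0 ltW.
    pose f1 y := ((2 * rate^-1 * lam i)%:E *
       (expR (rate * `|b y - amean x h|) * w y)%R%:E).
    pose f2 y := ((2 * rate^-1 * (1 - ln (lam i)))%:E * (Phi (g y) * w y)%R%:E).
    have c1 : (0 <= 2 * rate^-1 * lam i)%R.
      by apply: mulr_ge0; [exact: mulr_ge0|exact: ltW].
    have c2 : (0 <= 2 * rate^-1 * (1 - ln (lam i)))%R.
      by apply: mulr_ge0 => //; exact: mulr_ge0.
    have e0 y : 0 <= (expR (rate * `|b y - amean x h|) * w y)%R%:E.
      by rewrite lee_fin mulr_ge0// expR_ge0.
    have p0 y : 0 <= (Phi (g y) * w y)%R%:E by rewrite lee_fin mulr_ge0// Phi_ge0.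
    have me : measurable_fun (Q i) (fun y => (expR (rate * `|b y - amean x h|) * w y)%R%:E).
      apply/measurable_EFinP; apply: measurable_funTS.
      by apply: measurable_funM; [exact: measurable_exp_osc|exact: mw].
    have mp : measurable_fun (Q i) (fun y => (Phi (g y) * w y)%R%:E).
      by apply/measurable_EFinP; exact: measurable_funTS.
    apply: (@le_trans _ _ (\int[leb]_(y in Q i) (f1 y + f2 y))).
      apply: ge0_le_integral; first exact: mQ.
      - by move=> y _; rewrite lee_fin !mulr_ge0.
      - apply/measurable_EFinP; apply: measurable_funTS.
        apply: measurable_funM; last exact: mw.
        by apply: measurable_funM; [exact: mosc|exact: mg].
      - by apply: emeasurable_funD; apply: measurable_funeM; [exact: me|exact: mp].
      - move=> y _; rewrite /f1 /f2 -!EFinM -EFinD lee_fin.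
        rewrite [(2 * rate^-1 * lam i * _)%R]mulrA [(_ * (1 - ln (lam i)) * _)%R]mulrA.
        rewrite -mulrDl ler_wpM2r//.
        have u0 : (0 <= rate * `|b y - amean x h|)%R by rewrite mulr_ge0// ltW.
        have Y := ler_wpM2l ri0 (Phi_young u0 (g_ge0 y) (lam01 i)).
        move: Y; rewrite -(mulrA rate) mulKf ?gt_eqF// => /le_trans; apply.
        by rewrite le_eqVlt; apply/orP; left; apply/eqP; ring.
    rewrite ge0_integralD//; try by move=> y _; rewrite mule_ge0.
    - rewrite !ge0_integralZl//; apply: leeD; rewrite [leRHS]EFinM; apply: lee_wpmul2l => //.
      exact: exp_integrable_far.
    - exact: measurable_funeM.
    - exact: measurable_funeM.
  rewrite -EFinD -EFinM -EFinD lee_fin mulrDr; apply: lerD.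
    rewrite le_eqVlt; apply/orP; left; apply/eqP.
    rewrite /al /lam exprMn exprVn; field.
    by rewrite !expf_neq0 ?gt_eqF.
  have wd0 := weight_decay_ge0 x h_gt0.
  have ti0 : (0 <= tail_ratio ^+ i)%R by rewrite exprn_ge0// ltW.
  have L0 : (0 <= L)%R by rewrite /L; lra.
  have lin := linear_geometric_le i (tail_ratio01).
  have dec : (Wi^-1 * Wi `^ kappa <=
      weight_decay x h * tail_ratio ^+ i * tail_ratio ^+ i)%R.
    exact: weight_decay_le.
  have dec0 : (0 <= Wi^-1 * Wi `^ kappa)%R := weight_decay_ge0 x (hi0 i).
  have key : ((1 - ln (lam i)) * (Wi^-1 * Wi `^ kappa) <=
      L * weight_decay x h * tail_ratio ^+ i * (1 - tail_ratio)^-1)%R.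
    apply: (@le_trans _ _ (L * i.+1%:R *
        (weight_decay x h * tail_ratio ^+ i * tail_ratio ^+ i))%R).
      exact: ler_pM.
    have -> : (L * i.+1%:R * (weight_decay x h * tail_ratio ^+ i * tail_ratio ^+ i) =
        L * weight_decay x h * tail_ratio ^+ i * (i.+1%:R * tail_ratio ^+ i))%R by ring.
    apply: ler_wpM2l; last exact: lin.
    by apply: mulr_ge0; [exact: mulr_ge0 L0 wd0|exact: ti0].
  have c0 : (0 <= 2 * rate^-1 * S)%R by apply: mulr_ge0 => //; exact: mulr_ge0.
  have := ler_wpM2l c0 key; rewrite /be.
  move: (weight_decay x h) (Wi `^ kappa)%R (ln (lam i)) (rate^-1)%R (L) => wd Wk ll ra L' hh.
  apply: le_trans (le_trans hh _); rewrite le_eqVlt; apply/orP; left; apply/eqP; ring.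
rewrite nneseriesD; try by move=> i _ _; rewrite lee_fin mulr_ge0// exprn_ge0// ?invr_ge0// ltW.
rewrite EFinD; apply: leeD.
  apply: le_trans (geometric_eseries_le al0 _) _; first by apply/andP; split; lra.
  by rewrite lee_fin le_eqVlt; apply/orP; left; apply/eqP; rewrite /al; field; rewrite gt_eqF.
apply: le_trans (geometric_eseries_le be0 _) _; first by rewrite t0.
rewrite lee_fin le_eqVlt; apply/orP; left; apply/eqP; rewrite /be -/L.
move: (weight_decay x h) (rate^-1)%R (L) => wd ra L'; field.
by rewrite subr_eq0 gt_eqF.
Qed.

End fixed_function.
End tails.

(** * The kernel away from a ball *)

(** For functions that need not be measurable: the integral of a nonnegative
function is a supremum over the simple functions below it. *)
Lemma ge0_le_integralT d (T : measurableType d) (R : realType)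
    (mu : {measure set T -> \bar R}) (f g : T -> \bar R) :
  (forall x, 0 <= f x) -> (forall x, f x <= g x) ->
  \int[mu]_x f x <= \int[mu]_x g x.
Proof.
move=> f0 fg; have g0 x : 0 <= g x by exact: le_trans (f0 x) (fg x).
rewrite !ge0_integralTE//; apply: ereal_sup_le => _ [h hf <-].
by exists h => // x; exact: le_trans (hf x) (fg x).
Qed.

Section kernel.
Context {R : realType} {n : nat}.
Notation V := (Rn R n).
Variables (w : V -> R) (A : R).
Hypothesis wA : A1_on_cubes w A.
Let w_ge0 := A1_ge0 wA.
Let mw := A1_measurable wA.
Variables (b : V -> R) (t : R).
Hypothesis mb : measurable_fun [set: V] b.
Variables (x0 : V) (r : R).
Hypothesis r_gt0 : (0 < r)%R.
Notation Q i := (ccube x0 (2 ^+ i * r)%R).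

(** Let [Q i] be the first of the cubes that contains [y]. Since [y] is not in
[Q i.-1] and [i > 1], its distance to the ball is at least one eighth of the
side of [Q i]. *)
Lemma kernel_far (x y : V) : eball x0 r x -> ~ Q 1%N y -> exists i, Q i y /\
  ((enorm (x - y) ^+ n)^-1 <= 8 ^+ n * ((2 ^+ i * r) *+ 2) ^- n)%R.
Proof.
move=> xr yQ1; pose P i := `[< Q i y >].
have ex : exists i, P i.
  pose e := (enorm (y - x0) / r)%R.
  exists (Num.truncn e).+1; apply/asboolP; apply: eball_sub_ccube.
  rewrite /eball/= -ltr_pdivrMr//; apply: lt_le_trans (truncnS_gt e) _.
  by rewrite -natrX ler_nat ltnW// ltn_expl.
case: (ex_minnP ex) => i /asboolP yi imin; exists i; split => //.
case: i yi imin => [|[|i]] yi imin; [exfalso|by []|].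
  by apply: yQ1; apply: ccube_sub yi; rewrite expr0 mul1r expr1 mulrDl mul1r lerDl ltW.
have nyi : ~ Q i.+1 y by move=> /asboolP/imin; rewrite ltnn.
have [l yl] : exists l, (2 ^+ i.+1 * r <= `|y ord0 l - x0 ord0 l|)%R.
  apply: contrapT => /forallNP h; apply: nyi; apply/ccubeP => l.
  by have /negP := h l; rewrite -ltNge ltr_norml => /andP[? ?]; lra.
have h2 : (1 <= 2 ^+ i :> R)%R by rewrite exprn_ege1// ler1n.
have side : ((2 ^+ i.+2 * r) *+ 2 / 8 <= enorm (x - y))%R.
  apply: le_trans (coord_le_enorm _ l).
  have xl := le_lt_trans (coord_le_enorm (x - x0)%R l) xr.
  move: xl; rewrite !mxE => xl.
  have tri := ler_distD (x ord0 l) (y ord0 l) (x0 ord0 l).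
  rewrite [(`|y ord0 l - x ord0 l|)%R]distrC in tri.
  move: yl; rewrite !exprS mulr2n.
  have : (r <= 2 ^+ i * r)%R by rewrite ler_peMl// ltW.
  move: (2 ^+ i)%R => p; lra.
have s0 : (0 < (2 ^+ i.+2 * r) *+ 2)%R by rewrite mulrn_wgt0// mulr_gt0// exprn_gt0.
have e0 : (0 < enorm (x - y))%R by apply: lt_le_trans side; rewrite divr_gt0.
have -> : (8 ^+ n * ((2 ^+ i.+2 * r) *+ 2) ^- n = (((2 ^+ i.+2 * r) *+ 2 / 8) ^+ n)^-1)%R.
  by rewrite exprMn exprVn invfM invrK mulrC.
rewrite lef_pV2 ?posrE ?exprn_gt0 ?divr_gt0//.
by apply: lerXn2r; rewrite ?nnegrE; [apply: ltW; rewrite divr_gt0|exact: ltW|exact: side].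
Qed.

Lemma kernel_integral_le (phi : V -> R) (x : V) :
  measurable_fun [set: V] phi -> (forall y, 0 <= phi y)%R ->
  (forall y, Q 1%N y -> phi y = 0%R) -> eball x0 r x ->
  \int[leb]_y (`|b x - b y| * phi y / enorm (x - y) ^+ n)%R%:E <=
  (8 ^+ n * A * unit_vol R n)%:E *
    ((`|b x - t|)%:E * \sum_(i <oo) ((ccubew w x0 (2 ^+ i * r))^-1%:E *
        \int[leb]_(y in Q i) (phi y * w y)%R%:E) +
     \sum_(i <oo) ((ccubew w x0 (2 ^+ i * r))^-1%:E *
        \int[leb]_(y in Q i) (`|b y - t| * phi y * w y)%R%:E)).
Proof.
move=> mphi phi0 phiQ xr.
have hi0 i : (0 < 2 ^+ i * r)%R by rewrite mulr_gt0// exprn_gt0.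
have si0 i : (0 < (2 ^+ i * r) *+ 2)%R by rewrite mulrn_wgt0.
have mQ i : measurable (Q i) by exact: measurable_ccube.
have mF : measurable_fun [set: V] (fun y => (`|b x - t| + `|b y - t|) * phi y)%R.
  apply: measurable_funM; last exact: mphi.
  by apply: measurable_funD; [exact: measurable_cst|exact: measurable_osc].
pose F y := (((`|b x - t| + `|b y - t|) * phi y)%R%:E : \bar R).
have F0 y : 0 <= F y by rewrite lee_fin mulr_ge0// addr_ge0.
have mEF : measurable_fun [set: V] F by apply/measurable_EFinP.
pose c i : R := (8 ^+ n * ((2 ^+ i * r) *+ 2) ^- n)%R.
have c0 i : (0 <= c i)%R by rewrite mulr_ge0 ?exprn_ge0// invr_ge0 exprn_ge0// ltW.
have p0 i y : 0 <= (F \_ (Q i)) y by rewrite patchE; case: ifP.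
have mp i : measurable_fun [set: V] (F \_ (Q i)).
  by apply/(measurable_restrictT _ (mQ i)); exact: measurable_funTS.
have t0 i y : 0 <= (c i)%:E * (F \_ (Q i)) y by rewrite mule_ge0// lee_fin.
apply: (@le_trans _ _ (\int[leb]_y \sum_(i <oo) ((c i)%:E * (F \_ (Q i)) y))).
  apply: ge0_le_integralT => y.
    by rewrite lee_fin divr_ge0 ?mulr_ge0// exprn_ge0// sqrtr_ge0.
  have [yQ|yQ] := pselect (Q 1%N y).
    by rewrite (phiQ _ yQ) mulr0 mul0r; apply: nneseries_ge0 => i _ _.
  have [i [yi ker]] := kernel_far xr yQ.
  apply: (@le_trans _ _ ((c i)%:E * (F \_ (Q i)) y)); last first.
    apply: le_trans (nneseries_lim_ge i.+1 _); last by move=> j _ _.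
    rewrite big_nat_recr//=; apply: leeDr.
    by apply: sume_ge0 => j _.
  rewrite patchE mem_set// -EFinM lee_fin mulrC; apply: ler_pM => //.
  - by rewrite invr_ge0 exprn_ge0// sqrtr_ge0.
  - by rewrite mulr_ge0.
  apply: ler_wpM2r => //; rewrite [(`|b y - t|)%R]distrC; exact: ler_distD.
rewrite (integral_nneseries leb measurableT
  (fun i => measurable_funeM (c i)%:E (mp i)) (fun i y _ => t0 i y)).
have w1 i : 0 <= (phi i * w i)%R%:E by rewrite lee_fin mulr_ge0.
have w2 i : 0 <= (`|b i - t| * phi i * w i)%R%:E by rewrite lee_fin !mulr_ge0.
have Wi i : (0 < ccubew w x0 (2 ^+ i * r))%R by exact: (ccubew_gt0 wA).
have W1 i : 0 <= (ccubew w x0 (2 ^+ i * r))^-1%:E *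
    \int[leb]_(y in Q i) (phi y * w y)%R%:E.
  by rewrite mule_ge0 ?integral_ge0// lee_fin invr_ge0 ltW.
have W2 i : 0 <= (ccubew w x0 (2 ^+ i * r))^-1%:E *
    \int[leb]_(y in Q i) (`|b y - t| * phi y * w y)%R%:E.
  by rewrite mule_ge0 ?integral_ge0// lee_fin invr_ge0 ltW.
rewrite -nneseriesZl// -nneseriesD//; last first.
  by move=> i _ _; apply: mule_ge0; [rewrite lee_fin|exact: W1].
have k0 : (0 <= 8 ^+ n * A * unit_vol R n)%R.
  apply: mulr_ge0; last exact: unit_vol_ge0.
  by apply: mulr_ge0; [exact: exprn_ge0|exact: ltW (A1_const_gt0 wA)].
rewrite -nneseriesZl//; last first.
  move=> i _; apply: adde_ge0; last exact: W2.
  by apply: mule_ge0; [rewrite lee_fin|exact: W1].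
apply: lee_nneseries => [i _ _|i _]; first exact: integral_ge0.
rewrite ge0_integralZl//; last by rewrite lee_fin.
rewrite -integral_mkcond.
have A1 := A1_integral wA (si0 i) (mQ i) (@subset_refl _ (Q i)) mEF F0.
have -> : (8 ^+ n * A * unit_vol R n)%:E *
   ((`|b x - t|)%:E * ((ccubew w x0 (2 ^+ i * r))^-1%:E * \int[leb]_(y in Q i) (phi y * w y)%R%:E) +
    (ccubew w x0 (2 ^+ i * r))^-1%:E * \int[leb]_(y in Q i) (`|b y - t| * phi y * w y)%R%:E) =
   (c i * (ccubew w x0 (2 ^+ i * r))^-1)%:E *
   ((A * (((2 ^+ i * r) *+ 2) ^+ n * unit_vol R n))%:E * \int[leb]_(y in Q i) (F y * (w y)%:E)).
  have -> : \int[leb]_(y in Q i) (F y * (w y)%:E) =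
      (`|b x - t|)%:E * \int[leb]_(y in Q i) (phi y * w y)%R%:E +
      \int[leb]_(y in Q i) (`|b y - t| * phi y * w y)%R%:E.
    have m1 : measurable_fun (Q i) (fun y => (phi y * w y)%R%:E).
      apply/measurable_EFinP; apply: measurable_funTS.
      by apply: measurable_funM; [exact: mphi|exact: mw].
    have m2 : measurable_fun (Q i) (fun y => (`|b y - t| * phi y * w y)%R%:E).
      apply/measurable_EFinP; apply: measurable_funTS.
      apply: measurable_funM; last exact: mw.
      by apply: measurable_funM; [exact: measurable_osc|exact: mphi].
    have n0 : 0 <= (`|b x - t|%R)%:E by rewrite lee_fin.
    rewrite -(ge0_integralZl leb (mQ i) m1 (fun y _ => w1 y) n0).
    rewrite -(ge0_integralD leb (mQ i) (fun y _ => mule_ge0 n0 (w1 y))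
      (measurable_funeM _ m1) (fun y _ => w2 y) m2).
    apply: eq_integral => y _; rewrite /F -!EFinM -EFinD; congr (_%:E).
    by ring.
  rewrite muleCA -ge0_muleDr//; last 2 first.
  - by rewrite mule_ge0// integral_ge0.
  - by rewrite integral_ge0.
  rewrite !muleA -!EFinM; congr (_%:E * _).
  rewrite /c; field.
  by rewrite expf_neq0 ?gt_eqF.
rewrite [X in _ <= X * _]EFinM -muleA; apply: lee_wpmul2l; first by rewrite lee_fin.
by rewrite lee_pdivlMl.
Qed.

End kernel.

(** * From balls to cubes *)

Section balls_and_cubes.
Context {R : realType} {n : nat}.
Notation V := (Rn R n).
Implicit Types (c x : V) (r h s : R) (w b : V -> R).

Definition cube_center c s : V := (c + const_mx (s / 2))%R.

Lemma cube_ccube c s : cube c s = ccube (cube_center c s) (s / 2).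
Proof.
rewrite /ccube /cube_center addrK; congr cube.
by rewrite mulr2n -splitr.
Qed.

Definition cube_ball c s : set V := eball (cube_center c s) (n.+1%:R * (s / 2))%R.

Lemma cube_ball_eucl c s : (0 < s)%R -> eucl_ball (cube_ball c s).
Proof.
move=> s0; exists (cube_center c s), (n.+1%:R * (s / 2))%R; split => //.
by rewrite mulr_gt0// divr_gt0.
Qed.

Lemma cube_sub_ball c s : (0 < s)%R -> cube c s `<=` cube_ball c s.
Proof.
move=> s0; rewrite cube_ccube; apply: ccube_sub_eball.
  by rewrite divr_ge0// ltW.
by rewrite ltr_pM2r ?divr_gt0// ltr_nat.
Qed.

Lemma leb_eball_le x r : (0 < r)%R ->
  leb (eball x r) <= ((r *+ 2) ^+ n * unit_vol R n)%:E.
Proof.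
move=> r0; rewrite -(leb_ccube x r0); apply: le_measure; rewrite ?inE.
- exact: measurable_eball.
- exact: measurable_ccube.
- exact: eball_sub_ccube.
Qed.

Lemma leb_cube_ball_le c s : (0 < s)%R ->
  leb (cube_ball c s) <= (n.+1%:R ^+ n)%:E * leb (cube c s).
Proof.
move=> s0; apply: le_trans (leb_eball_le _ _) _.
  by rewrite mulr_gt0// divr_gt0.
rewrite leb_cube// -EFinM lee_fin [leRHS]mulrA; apply: ler_wpM2r; first exact: unit_vol_ge0.
by rewrite -mulrnAr exprMn [in leLHS]mulr2n -splitr.
Qed.

Lemma leb_eball_fin x r : (0 < r)%R -> leb (eball x r) \is a fin_num.
Proof.
move=> r0; rewrite ge0_fin_numE ?measure_ge0//.
by apply: le_lt_trans (leb_eball_le x r0) _; rewrite ltry.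
Qed.

Definition inner_side r : R := (r / n.+1%:R)%R.

Lemma inner_side_gt0 r : (0 < r)%R -> (0 < inner_side r)%R.
Proof. by move=> r0; rewrite divr_gt0. Qed.

Lemma inner_cube_sub x r : (0 < r)%R -> ccube x (inner_side r) `<=` eball x r.
Proof.
move=> r0; apply: ccube_sub_eball; first exact/ltW/inner_side_gt0.
by rewrite /inner_side mulrCA gtr_pMr// ltr_pdivrMr// mul1r ltr_nat.
Qed.

Lemma leb_eball_gt0 x r : (0 < unit_vol R n)%R -> (0 < r)%R -> 0 < leb (eball x r).
Proof.
move=> u0 r0; apply: (@lt_le_trans _ _ (leb (ccube x (inner_side r)))).
  rewrite leb_ccube ?inner_side_gt0// lte_fin mulr_gt0// exprn_gt0//.
  by rewrite mulrn_wgt0// inner_side_gt0.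
apply: le_measure; rewrite ?inE.
- exact: measurable_ccube.
- exact: measurable_eball.
- exact: inner_cube_sub.
Qed.

Lemma ess_inf_on_ge0 w B : (forall x, 0 <= w x)%R -> 0 <= ess_inf_on w B.
Proof.
move=> w0; apply/ess_infP; apply: nearW => x; rewrite /patch.
by case: ifP => _ /=; rewrite ?lee_fin ?leey.
Qed.

Lemma muckenhoupt_ball w (C : R) x r : is_weight w ->
  (0 < unit_vol R n)%R -> (0 < r)%R ->
  (leb (eball x r))^-1 * weight_measure w (eball x r) <=
    C%:E * ess_inf_on w (eball x r) ->
  {ae leb, forall y, eball x r y ->
    weight_measure w (eball x r) <= (`|C|%R)%:E * leb (eball x r) * (w y)%:E}.
Proof.
move=> [w0 _ _] u0 r0 A1; set B := eball x r in A1 *.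
have e0 : 0 <= ess_inf_on w B by exact: ess_inf_on_ge0.
have := ess_inf_le leb (patch (cst +oo) B (EFin \o w)).
apply: filterS => y; rewrite /patch => ey By; move: ey; rewrite mem_set// => ey.
have l0 : 0 < leb B by exact: leb_eball_gt0.
move: A1 l0; rewrite -(fineK (leb_eball_fin x r0)) -/B; set l := fine _ => A1.
rewrite lte_fin => l0; move: A1; rewrite inver gt_eqF// lee_pdivrMl// => A1.
apply: (le_trans A1); rewrite [(`|C|%R)%:E * _]muleC -muleA; apply: lee_wpmul2l.
  by rewrite lee_fin ltW.
apply: (@le_trans _ _ ((`|C|%R)%:E * ess_inf_on w B)).
  by apply: lee_wpmul2r => //; rewrite lee_fin ler_norm.
by apply: lee_wpmul2l => //; rewrite lee_fin.
Qed.

Lemma weight_fin w (E : set V) c s : is_weight w -> measurable E ->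
  E `<=` cube c s -> weight_measure w E < +oo.
Proof.
move=> [w0 lw _] mE EQ; apply: (@le_lt_trans _ _ (weight_measure w (cube c s))).
  by apply: le_weight_measure => //; [exact: lw.1|exact: measurable_cube].
rewrite /weight_measure.
under eq_integral => x _ do rewrite -[w x]ger0_norm//.
exact: loc_integrable_cube.
Qed.

(** A weight vanishing almost everywhere on each of the cubes that exhaust the
space would vanish almost everywhere. *)
Lemma weight_big_cube_gt0 w : is_weight w ->
  exists k : nat, 0 < weight_measure w (ccube 0%R k.+1%:R).
Proof.
move=> [w0 lw]; apply: contraPP => /forallNP h; apply/negP; rewrite -leNgt.
have mw := lw.1.
pose E (k : nat) : set V := ccube 0%R k.+1%:R `&` [set x | (0 < w x)%R].
have mE k : measurable (E k).
  apply: measurableI; first exact: measurable_ccube.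
  rewrite -[X in measurable X]setTI.
  rewrite (_ : [set x | _] = w @^-1` `]0%R, +oo[%classic); first exact: mw.
  by apply/seteqP; split => x /=; rewrite in_itv/= andbT.
have -> : [set x | (0 < w x)%R] = \bigcup_k E k.
  by rewrite /E -setI_bigcupl bigcup_ccube setTI.
rewrite (_ : leb _ = 0)//; apply/negligibleP; first exact: bigcupT_measurable.
apply: negligible_bigcup => k; apply/negligibleP; first exact: mE.
have Wk : \int[leb]_(x in ccube 0%R k.+1%:R) `|(w x)%:E| = 0.
  apply/eqP; rewrite eq_le integral_ge0 ?andbT; last by move=> x _; exact: abse_ge0.
  have := h k; move/negP; rewrite -leNgt; apply: le_trans.
  by under eq_integral => x _ do rewrite gee0_abs ?lee_fin//.
have mEw : measurable_fun (ccube 0%R k.+1%:R : set V) (EFin \o w).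
  exact: measurable_EFinw.
have [+ _] := @ae_eq_integral_abs _ _ _ leb _ (measurable_ccube 0%R k.+1%:R) _ mEw.
move=> /(_ Wk) [N [mN N0 sub]].
apply: (subset_measure0 _ mN) => // x [xk wx]; apply: sub => /=.
by move=> /(_ xk)[] /eqP; rewrite gt_eqF.
Qed.

(** A cube and its circumscribed ball have comparable measures. For the
positivity of the weight of a cube, a larger cube of positive weight gives an
almost everywhere positive lower bound of [w]. *)
Lemma muckenhoupt_cubes w : muckenhoupt_A1 w -> exists A, A1_on_cubes w A.
Proof.
move=> [ww [C AC]]; have [w0 lw wpos] := ww; have mw := lw.1.
have u0 : (0 < unit_vol R n)%R.
  apply: unit_vol_gt0 wpos; rewrite -[X in measurable X]setTI.
  rewrite (_ : [set x | _] = w @^-1` `]0%R, +oo[%classic); first exact: mw.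
  by apply/seteqP; split => x /=; rewrite in_itv/= andbT.
pose A := Num.max 1%R (`|C| * n.+1%:R ^+ n)%R.
have ae c s : (0 < s)%R -> {ae leb, forall y, cube c s y ->
    weight_measure w (cube c s) <= A%:E * leb (cube c s) * (w y)%:E}.
  move=> s0; have h0 : (0 < n.+1%:R * (s / 2))%R by rewrite mulr_gt0// divr_gt0.
  have := muckenhoupt_ball ww u0 h0 (AC _ (cube_ball_eucl c s0)).
  apply: filterS => y By /[dup] yQ /(cube_sub_ball s0) /By.
  move=> h; apply: (@le_trans _ _ (weight_measure w (cube_ball c s))).
    apply: le_weight_measure => //; first exact: measurable_cube.
      exact: measurable_eball.
    exact: cube_sub_ball.
  apply: (le_trans h); apply: lee_wpmul2r; first by rewrite lee_fin.
  apply: (@le_trans _ _ ((`|C|%R)%:E * ((n.+1%:R ^+ n)%:E * leb (cube c s)))).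
    by apply: lee_wpmul2l; [rewrite lee_fin|exact: leb_cube_ball_le].
  rewrite muleA -EFinM; apply: lee_wpmul2r; first exact: measure_ge0.
  by rewrite lee_fin /A le_max lexx orbT.
exists A; split => //.
- by rewrite /A le_max lexx.
- by move=> c s; exact: (@weight_fin w (cube c s) c s ww (measurable_cube c s)).
- move=> c s s0.
  have [k Wk] := weight_big_cube_gt0 ww.
  pose m := maxn k (Num.truncn (enorm c + s)%R).
  pose B : set V := ccube 0%R m.+1%:R.
  have QB : cube c s `<=` B.
    have e1 : (enorm c + s < m.+1%:R)%R.
      by apply: lt_le_trans (truncnS_gt _) _; rewrite ler_nat ltnS leq_maxr.
    move=> y /cubeP yc; apply/ccubeP => i; have /andP[lo hi] := yc i.
    have := coord_le_enorm c i; rewrite ler_norml !mxE => /andP[? ?]; lra.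
  have mB : measurable B by exact: measurable_ccube.
  have WB : 0 < weight_measure w B.
    apply: lt_le_trans Wk _; apply: le_weight_measure => //; first exact: measurable_ccube.
    by apply: ccube_sub; rewrite ler_nat ltnS leq_maxl.
  have s'0 : (0 < m.+1%:R *+ 2 :> R)%R by rewrite mulrn_wgt0.
  have finB : weight_measure w B \is a fin_num.
    rewrite ge0_fin_numE ?weight_measure_ge0//.
    exact: (@weight_fin w B _ _ ww mB (@subset_refl _ B)).
  have A0 : (0 < A)%R by rewrite /A lt_max ltr01.
  have lB : leb B = ((m.+1%:R *+ 2) ^+ n * unit_vol R n)%:E by rewrite leb_cube.
  have lB0 : (0 < A * ((m.+1%:R *+ 2) ^+ n * unit_vol R n))%R.
    by rewrite !mulr_gt0// exprn_gt0.
  pose q := (fine (weight_measure w B) / (A * ((m.+1%:R *+ 2) ^+ n * unit_vol R n)))%R.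
  have q0 : (0 < q)%R.
    apply: divr_gt0 lB0; apply: fine_gt0; rewrite WB/= -ge0_fin_numE; first exact: finB.
    exact: weight_measure_ge0.
  apply: (@lt_le_trans _ _ (\int[leb]_(y in cube c s) (cst q%:E y))).
    rewrite integral_cst; last exact: measurable_cube.
    rewrite [X in _ * X](leb_cube c s0) -EFinM lte_fin; apply: mulr_gt0 => //.
    by apply: mulr_gt0 => //; exact: exprn_gt0.
  apply: ae_ge0_le_integral.
  - exact: measurable_cube.
  - by move=> y _; rewrite lee_fin ltW.
  - exact: measurable_cst.
  - by move=> y _; rewrite lee_fin.
  - exact: measurable_EFinw.
  have := ae (0 - const_mx m.+1%:R)%R (m.+1%:R *+ 2)%R s'0.
  apply: filterS => y By /QB/By; rewrite -/(ccube _ _) -/B lB.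
  by rewrite -(fineK finB) -!EFinM !lee_fin ler_pdivrMr// mulrC.
Qed.

(** The oscillation over a cube is measured around the mean over the
circumscribed ball, so that no mean over a cube has to be computed. *)
Lemma bmo_cubes b : (0 < unit_vol R n)%R -> BMO b ->
  exists beta : R, (0 < beta)%R /\ forall c s, (0 < s)%R ->
    \int[leb]_(x in cube c s) (`|b x - ball_mean b (cube_ball c s)|%R)%:E <=
    beta%:E * leb (cube c s).
Proof.
move=> u0 [[mb _] bfin].
pose N := Num.max 1%R (fine (BMO_norm b)).
have N0 : (0 < N)%R by rewrite /N lt_max ltr01.
exists (N * n.+1%:R ^+ n)%R; split; first by rewrite mulr_gt0// exprn_gt0.
move=> c s s0; set B := cube_ball c s.
have Bb := cube_ball_eucl c s0.
have h0 : (0 < n.+1%:R * (s / 2))%R by rewrite mulr_gt0// divr_gt0.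
have mosc : measurable_fun [set: V] (fun x => `|b x - ball_mean b B|%R).
  exact: measurable_osc.
have I0 : 0 <= \int[leb]_(x in B) (`|b x - ball_mean b B|%R)%:E.
  by apply: integral_ge0 => x _; rewrite lee_fin.
have le : (leb B)^-1 * \int[leb]_(x in B) (`|b x - ball_mean b B|%R)%:E <= BMO_norm b.
  by apply: ereal_sup_ubound; exists B.
have l0 : 0 < leb B by exact: leb_eball_gt0.
have lfin : leb B \is a fin_num by exact: leb_eball_fin.
have leN : (leb B)^-1 * \int[leb]_(x in B) (`|b x - ball_mean b B|%R)%:E <= N%:E.
  apply: (le_trans le); rewrite -[leLHS]fineK.
    by rewrite lee_fin /N le_max lexx orbT.
  rewrite ge0_fin_numE//; apply: le_trans le; apply: mule_ge0 => //.
  by rewrite inve_ge0 ltW.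
apply: (@le_trans _ _ (\int[leb]_(x in B) (`|b x - ball_mean b B|%R)%:E)).
  apply: ge0_subset_integral.
  - exact: measurable_cube.
  - exact: measurable_eball.
  - by apply/measurable_EFinP; exact: measurable_funTS.
  - by move=> x _; rewrite lee_fin.
  - exact: cube_sub_ball.
apply: (@le_trans _ _ (N%:E * leb B)).
  move: leN l0; rewrite -(fineK lfin) lte_fin; move: (fine (leb B)) => l + l0.
  by rewrite inver gt_eqF// lee_pdivrMl// muleC.
rewrite EFinM -muleA; apply: lee_wpmul2l; first by rewrite lee_fin ltW.
exact: leb_cube_ball_le.
Qed.

End balls_and_cubes.

(** * The contribution of the part of f far from the ball *)

Section far_part.
Context {R : realType} {n : nat}.
Notation V := (Rn R n).
Hypothesis n_gt0 : (0 < n)%N.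
Variables (w : V -> R) (A : R).
Hypothesis wA : A1_on_cubes w A.
Notation W := (weight_measure w).
Let w_ge0 := A1_ge0 wA.
Let mw := A1_measurable wA.
Variables (b : V -> R) (a : V -> R -> R) (beta : R).
Hypothesis mb : measurable_fun [set: V] b.
Hypothesis beta_gt0 : (0 < beta)%R.
Hypothesis mean_osc : forall c s, (0 < s)%R ->
  \int[leb]_(x in cube c s) (`|b x - a c s|%R)%:E <= beta%:E * leb (cube c s).
Variable kappa : R.
Hypothesis kappa_lt1 : (kappa < 1)%R.

Let rate := @exp_rate R n A beta.
Let K := exp_const A.
Let tau := tail_ratio A kappa.

Definition far_linear : R := (1 - tau)^-1%R.
Definition far_log (d : R) : R :=
  (2 * rate^-1 * (1 - ln d + ln (2 * exp_base A)) / (1 - tau) ^+ 2)%R.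
Definition kernel_const : R := (8 ^+ n * A * unit_vol R n)%R.

Lemma kernel_const_gt0 : (0 < kernel_const)%R.
Proof.
rewrite /kernel_const; apply: mulr_gt0; last exact: (A1_unit_vol_gt0 wA).
by apply: mulr_gt0; [exact: exprn_gt0|exact: (A1_const_gt0 wA)].
Qed.

Lemma far_linear_ge0 : (0 <= far_linear)%R.
Proof.
have /andP[_ t1] := tail_ratio01 wA kappa_lt1.
by rewrite /far_linear invr_ge0 subr_ge0 ltW.
Qed.

Lemma far_log_ge0 d : (0 < d <= 1)%R -> (0 <= far_log d)%R.
Proof.
move=> /andP[d0 d1]; have /andP[_ t1] := tail_ratio01 wA kappa_lt1.
have lnd : (0 <= - ln d)%R by rewrite oppr_ge0 ln_le0.
have b1 := exp_base_gt1 wA.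
have lnb : (0 <= ln (2 * exp_base A))%R by apply: ln_ge0; lra.
have r0 : (0 <= rate^-1)%R by rewrite invr_ge0; exact: ltW (exp_rate_gt0 wA beta_gt0).
apply: mulr_ge0; last by rewrite invr_ge0 exprn_ge0// subr_ge0 ltW.
by apply: mulr_ge0; [exact: mulr_ge0|lra].
Qed.

Variables (x0 : V) (r S sigma c d : R) (g F : V -> R).
Hypotheses (r_gt0 : (0 < r)%R) (S_ge0 : (0 <= S)%R) (sigma_gt0 : (0 < sigma)%R).
Hypotheses (c_ge0 : (0 <= c)%R) (d01 : (0 < d <= 1)%R).
Notation Q i := (ccube x0 (2 ^+ i * r)%R).
Hypothesis mg : measurable_fun [set: V] g.
Hypothesis g_ge0 : forall y, (0 <= g y)%R.
Hypothesis gQ : forall y, Q 1%N y -> g y = 0%R.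
Hypothesis morrey : forall i,
  \int[leb]_(y in Q i) (Phi (g y) * w y)%R%:E <=
    (S * ccubew w x0 (2 ^+ i * r) `^ kappa)%:E.
Hypothesis mF : measurable_fun [set: V] F.
Hypothesis F_kernel : forall x, eball x0 r x -> (`|F x|%R)%:E <=
  c%:E * \int[leb]_y (`|b x - b y| * (sigma * g y) / enorm (x - y) ^+ n)%R%:E.
Hypothesis d_small : (c * kernel_const * (4 * rate^-1 * K * d) <= 4^-1)%R.

Let t := amean a x0 r.
Let D := weight_decay w kappa x0 r.

Let hi0 i : (0 < 2 ^+ i * r)%R.
Proof. by rewrite mulr_gt0// exprn_gt0. Qed.

Lemma far_pointwise x : eball x0 r x -> (`|F x| <=
  sigma * (c * kernel_const * (`|b x - t| * (S * D * far_linear) +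
    (4 * rate^-1 * K * d + far_log d * (S * D)))))%R.
Proof.
move=> xr; rewrite -lee_fin; apply: (le_trans (F_kernel xr)).
have msg : measurable_fun [set: V] (fun y => sigma * g y)%R.
  by apply: measurable_funM; [exact: measurable_cst|exact: mg].
have sg0 y : (0 <= sigma * g y)%R by rewrite mulr_ge0// ltW.
have sgQ y : Q 1%N y -> (sigma * g y = 0)%R by move=> /gQ->; rewrite mulr0.
have Wi i : (0 < ccubew w x0 (2 ^+ i * r))%R by exact: (ccubew_gt0 wA).
have k0 := kernel_const_gt0.
have ker := kernel_integral_le wA t mb r_gt0 msg sg0 sgQ xr.
have mgw : measurable_fun [set: V] (fun y => g y * w y)%R.
  by apply: measurable_funM; [exact: mg|exact: mw].
have mbgw : measurable_fun [set: V] (fun y => `|b y - t| * g y * w y)%R.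
  apply: measurable_funM; last exact: mw.
  by apply: measurable_funM; [exact: measurable_osc|exact: mg].
have gw0 y : 0 <= (g y * w y)%R%:E by rewrite lee_fin mulr_ge0.
have bgw0 y : 0 <= (`|b y - t| * g y * w y)%R%:E by rewrite lee_fin !mulr_ge0.
have E1 : \sum_(i <oo) ((ccubew w x0 (2 ^+ i * r))^-1%:E *
    \int[leb]_(y in Q i) (sigma * g y * w y)%R%:E) <=
    (sigma * (S * D * far_linear))%:E.
  rewrite (eq_eseriesr (g := fun i => sigma%:E * ((ccubew w x0 (2 ^+ i * r))^-1%:E *
      \int[leb]_(y in Q i) (g y * w y)%R%:E))); last first.
    move=> i _; rewrite muleCA; congr (_ * _); rewrite -ge0_integralZl//.
    - by apply: eq_integral => y _; rewrite -EFinM mulrA.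
    - exact: measurable_ccube.
    - by apply/measurable_EFinP; exact: measurable_funTS.
    - by rewrite lee_fin ltW.
  rewrite nneseriesZl; last first.
    move=> i _; apply: mule_ge0; first by rewrite lee_fin invr_ge0 ltW.
    exact: integral_ge0.
  rewrite EFinM; apply: lee_wpmul2l; first by rewrite lee_fin ltW.
  exact: (tail_linear n_gt0 wA kappa_lt1 r_gt0 S_ge0 mg g_ge0 morrey).
have E2 : \sum_(i <oo) ((ccubew w x0 (2 ^+ i * r))^-1%:E *
    \int[leb]_(y in Q i) (`|b y - t| * (sigma * g y) * w y)%R%:E) <=
    (sigma * (4 * rate^-1 * K * d + far_log d * (S * D)))%:E.
  rewrite (eq_eseriesr (g := fun i => sigma%:E * ((ccubew w x0 (2 ^+ i * r))^-1%:E *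
      \int[leb]_(y in Q i) (`|b y - t| * g y * w y)%R%:E))); last first.
    move=> i _; rewrite muleCA; congr (_ * _); rewrite -ge0_integralZl//.
    - by apply: eq_integral => y _; rewrite -EFinM; congr (_%:E); ring.
    - exact: measurable_ccube.
    - by apply/measurable_EFinP; exact: measurable_funTS.
    - by rewrite lee_fin ltW.
  rewrite nneseriesZl; last first.
    move=> i _; apply: mule_ge0; first by rewrite lee_fin invr_ge0 ltW.
    exact: integral_ge0.
  rewrite [leRHS]EFinM; apply: lee_wpmul2l; first by rewrite lee_fin ltW.
  exact: (tail_log n_gt0 wA mb beta_gt0 mean_osc kappa_lt1 r_gt0 S_ge0 mg g_ge0 morrey d01).
apply: (@le_trans _ _ (c%:E * (kernel_const%:E *
    ((`|b x - t|%R)%:E * (sigma * (S * D * far_linear))%:E +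
     (sigma * (4 * rate^-1 * K * d + far_log d * (S * D)))%:E)))).
  apply: lee_wpmul2l; first by rewrite lee_fin.
  apply: (le_trans ker); apply: lee_wpmul2l; first by rewrite lee_fin ltW.
  apply: leeD; last exact: E2.
  by apply: lee_wpmul2l; first by rewrite lee_fin.
rewrite -!EFinM lee_fin le_eqVlt; apply/orP; left; apply/eqP.
by ring.
Qed.

(** Chebyshev's inequality. By [d_small] the term with [d] takes at most half of
the level [sigma / 2], so that on the given set [p * e + q * w] below is at least
[w]; its integral over the cube is bounded by exponential integrability. *)
Lemma far_estimate :
  W [set x | eball x0 r x /\ (sigma / 2 < `|F x|)%R] <=
  (4 * c * kernel_const * (far_linear * rate^-1 * K + far_log d) *
    (S * ccubew w x0 r `^ kappa))%:E.
Proof.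
set E := [set x | _].
have r0 : (0 < rate)%R := exp_rate_gt0 wA beta_gt0.
have ri0 : (0 <= rate^-1)%R by rewrite invr_ge0 ltW.
have K0 : (0 < K)%R := exp_const_gt0 wA.
have k0 := kernel_const_gt0.
have D0 : (0 <= D)%R by exact: (weight_decay_ge0 wA).
have l0 := far_linear_ge0; have g0 := far_log_ge0 d01.
have mE : measurable E.
  apply: (@measurableI _ _ (eball x0 r) [set x | (sigma / 2 < `|F x|)%R]).
    exact: measurable_eball.
  rewrite -[X in measurable X]setTI.
  rewrite (_ : [set x | _] = (fun x => `|F x|%R) @^-1` `](sigma / 2)%R, +oo[%classic).
    by apply: measurableT_comp => //; exact: normr_measurable.
  by apply/seteqP; split => x /=; rewrite in_itv/= andbT.
pose p : R := (4 * c * kernel_const * (S * D) * (far_linear * rate^-1))%R.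
pose q : R := (4 * c * kernel_const * (S * D) * far_log d)%R.
have SD0 : (0 <= S * D)%R by exact: mulr_ge0.
have ck0 : (0 <= 4 * c * kernel_const)%R.
  by apply: mulr_ge0; [exact: mulr_ge0|exact: ltW].
have ckSD0 : (0 <= 4 * c * kernel_const * (S * D))%R by exact: mulr_ge0.
have p0 : (0 <= p)%R by apply: mulr_ge0 => //; exact: mulr_ge0.
have q0 : (0 <= q)%R by exact: mulr_ge0.
pose e x : R := (expR (rate * `|b x - t|) * w x)%R.
have e0 x : 0 <= (e x)%:E by rewrite lee_fin mulr_ge0// expR_ge0.
have me D' : measurable_fun D' (fun x => (e x)%:E).
  apply/measurable_EFinP; apply: measurable_funTS.
  by apply: measurable_funM; [exact: measurable_exp_osc|exact: mw].
have mwD D' : measurable_fun D' (fun x => (w x)%:E) by exact: measurable_EFinw.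
have w0 x : 0 <= (w x)%:E by rewrite lee_fin.
have mpq D' : measurable_fun D' (fun x => p%:E * (e x)%:E + q%:E * (w x)%:E).
  by apply: emeasurable_funD; exact: measurable_funeM.
have pq0 x : 0 <= p%:E * (e x)%:E + q%:E * (w x)%:E.
  by apply: adde_ge0; apply: mule_ge0 => //; rewrite lee_fin.
have EQ : E `<=` ccube x0 r by move=> x [/eball_sub_ccube].
apply: (@le_trans _ _ (\int[leb]_(x in E) (p%:E * (e x)%:E + q%:E * (w x)%:E))).
  apply: ge0_le_integral => // x [xr big].
  rewrite /e -!EFinM -EFinD lee_fin [(p * _)%R]mulrA -mulrDl -[leLHS]mul1r.
  apply: ler_wpM2r => //.
  have h := far_pointwise xr.
  have {}h : (2^-1 < c * kernel_const * (`|b x - t| * (S * D * far_linear) +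
      (4 * rate^-1 * K * d + far_log d * (S * D))))%R.
    by rewrite -(ltr_pM2l sigma_gt0); apply: lt_le_trans big h.
  have u1 : (`|b x - t| <= rate^-1 * expR (rate * `|b x - t|))%R.
    rewrite -ler_pdivrMl ?invr_gt0// invrK.
    by have := expR_ge1Dx (rate * `|b x - t|)%R; lra.
  have u2 : (4 * c * kernel_const * (S * D) * far_linear * `|b x - t| <=
      4 * c * kernel_const * (S * D) * far_linear *
      (rate^-1 * expR (rate * `|b x - t|)))%R.
    by apply: ler_wpM2l => //; exact: mulr_ge0.
  rewrite /p /q; have := d_small; lra.
apply: (@le_trans _ _ (\int[leb]_(x in ccube x0 r) (p%:E * (e x)%:E + q%:E * (w x)%:E))).
  by apply: ge0_subset_integral => //; exact: measurable_ccube.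
have -> : \int[leb]_(x in ccube x0 r) (p%:E * (e x)%:E + q%:E * (w x)%:E) =
    p%:E * \int[leb]_(x in ccube x0 r) (e x)%:E + q%:E * W (ccube x0 r).
  have mQ := measurable_ccube x0 r.
  rewrite -(ge0_integralZl leb mQ (me _) (fun x _ => e0 x)); last by rewrite lee_fin.
  rewrite -(ge0_integralZl leb mQ (mwD _) (fun x _ => w0 x)); last by rewrite lee_fin.
  apply: ge0_integralD.
  - exact: measurable_ccube.
  - by move=> x _; apply: mule_ge0 => //; rewrite lee_fin.
  - by apply: measurable_funeM.
  - by move=> x _; apply: mule_ge0 => //; rewrite lee_fin.
  - by apply: measurable_funeM.
have r20 : (0 < r *+ 2)%R by rewrite mulrn_wgt0.
have expI := exp_integrable wA mb beta_gt0 mean_osc (x0 - const_mx r)%R r20.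
apply: (@le_trans _ _ (p%:E * (K * ccubew w x0 r)%:E + q%:E * (ccubew w x0 r)%:E)).
  apply: leeD; apply: lee_wpmul2l; rewrite ?lee_fin//.
  by rewrite -/(W _) (ccubewE wA).
rewrite -!EFinM -EFinD lee_fin le_eqVlt; apply/orP; left; apply/eqP.
have W0 : (ccubew w x0 r != 0)%R by rewrite gt_eqF// (ccubew_gt0 wA).
rewrite /p /q /D /weight_decay; field.
by rewrite W0 gt_eqF.
Qed.

End far_part.

(** * Weights of balls, cut-off functions *)

Section weights_of_balls.
Context {R : realType} {n : nat}.
Notation V := (Rn R n).
Variables (w : V -> R) (A : R).
Hypothesis wA : A1_on_cubes w A.
Notation W := (weight_measure w).
Let w_ge0 := A1_ge0 wA.
Let mw := A1_measurable wA.

Lemma ccubew_le x h k : (0 < h)%R -> (1 <= k)%R ->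
  (ccubew w x (k * h) <= A * k ^+ n * ccubew w x h)%R.
Proof.
move=> h0 k1; have k0 : (0 < k)%R by apply: lt_le_trans k1.
have s0 : (0 < (k * h) *+ 2)%R by rewrite mulrn_wgt0// mulr_gt0.
have t0 : (0 < h *+ 2)%R by rewrite mulrn_wgt0.
have sub : ccube x h `<=` ccube x (k * h)%R by apply: ccube_sub; rewrite ler_peMl// ltW.
have := A1_doubling wA s0 t0 sub.
have tn0 : (0 < (h *+ 2) ^+ n)%R by rewrite exprn_gt0.
have -> : (((k * h) *+ 2) ^+ n = k ^+ n * (h *+ 2) ^+ n)%R.
  by rewrite -mulrnAr exprMn.
move=> le; rewrite -(ler_pM2r tn0); apply: (le_trans le).
by rewrite le_eqVlt; apply/orP; left; apply/eqP; rewrite /ccubew; ring.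
Qed.

Definition ball_const : R := (A * n.+1%:R ^+ n)%R.

Lemma ball_const_gt0 : (0 < ball_const)%R.
Proof. by apply: mulr_gt0; [exact: (A1_const_gt0 wA)|exact: exprn_gt0]. Qed.

Lemma weight_eball_fin x r : W (eball x r) \is a fin_num.
Proof.
rewrite ge0_fin_numE ?weight_measure_ge0//.
apply: (@le_lt_trans _ _ (W (ccube x r))); last exact: (A1_fin wA).
apply: le_weight_measure => //; [exact: measurable_eball|exact: measurable_ccube|].
exact: eball_sub_ccube.
Qed.

Lemma weight_eball_le x h : (0 < h)%R ->
  (fine (W (eball x (n.+1%:R * h)%R)) <= ball_const * ccubew w x h)%R.
Proof.
move=> h0; apply: (@le_trans _ _ (ccubew w x (n.+1%:R * h)%R)); last first.
  by apply: ccubew_le => //; rewrite ler1n.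
rewrite -lee_fin (fineK (weight_eball_fin _ _)) -(ccubewE wA).
apply: le_weight_measure => //; [exact: measurable_eball|exact: measurable_ccube|].
exact: eball_sub_ccube.
Qed.

Lemma ccubew_le_eball x r : (0 < r)%R ->
  (ccubew w x r <= ball_const * fine (W (eball x r)))%R.
Proof.
move=> r0; have i0 := @inner_side_gt0 R n r r0.
have -> : ccubew w x r = ccubew w x (n.+1%:R * @inner_side R n r)%R.
  by rewrite /inner_side mulrCA mulfV ?mulr1// pnatr_eq0.
apply: (@le_trans _ _ (ball_const * ccubew w x (@inner_side R n r))%R).
  by apply: ccubew_le => //; rewrite ler1n.
apply: ler_wpM2l; first exact/ltW/ball_const_gt0.
rewrite -lee_fin (fineK (weight_eball_fin _ _)) -(ccubewE wA).
apply: le_weight_measure => //; [exact: measurable_ccube|exact: measurable_eball|].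
exact: inner_cube_sub.
Qed.

Lemma weight_eball_gt0 x r : (0 < r)%R -> (0 < fine (W (eball x r)))%R.
Proof.
move=> r0; rewrite -(pmulr_rgt0 _ ball_const_gt0).
by apply: lt_le_trans (ccubew_le_eball x r0); exact: (ccubew_gt0 wA).
Qed.

Lemma poweR_weight_inv x r kappa : (0 < r)%R ->
  (W (eball x r) `^ kappa)^-1 = ((fine (W (eball x r)) `^ kappa)^-1)%R%:E.
Proof.
move=> r0; rewrite -[in LHS](fineK (weight_eball_fin x r)) poweR_EFin inver.
by rewrite gt_eqF// powR_gt0// weight_eball_gt0.
Qed.

(** The integral over a cube is at most the one over its circumscribed ball,
the weight of which is comparable by doubling. *)
Lemma morrey_cubes (G : V -> R) (S kappa : R) x h :
  (0 <= kappa)%R -> (0 <= S)%R -> (0 < h)%R ->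
  measurable_fun [set: V] G -> (forall y, 0 <= G y)%R ->
  (W (eball x (n.+1%:R * h)%R) `^ kappa)^-1 *
    \int[leb]_(y in eball x (n.+1%:R * h)%R) (G y)%:E <= S%:E ->
  \int[leb]_(y in ccube x h) (G y)%:E <=
    (S * ball_const `^ kappa * ccubew w x h `^ kappa)%:E.
Proof.
move=> k0 S0 h0 mG G0; have H0 : (0 < n.+1%:R * h)%R by rewrite mulr_gt0.
rewrite poweR_weight_inv// lee_pdivrMl ?powR_gt0 ?weight_eball_gt0// => le.
apply: (@le_trans _ _ (\int[leb]_(y in eball x (n.+1%:R * h)%R) (G y)%:E)).
  apply: ge0_subset_integral.
  - exact: measurable_ccube.
  - exact: measurable_eball.
  - by apply/measurable_EFinP; exact: measurable_funTS.
  - by move=> y _; rewrite lee_fin.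
  - by apply: ccube_sub_eball; [exact: ltW|rewrite ltr_pM2r// ltr_nat].
apply: (le_trans le); rewrite -EFinM lee_fin mulrC -mulrA; apply: ler_wpM2l => //.
have b0 := ltW ball_const_gt0; have c0 := ltW (ccubew_gt0 wA x h0).
rewrite -powRM//; apply: ge0_ler_powR => //; rewrite ?nnegrE.
- exact/ltW/weight_eball_gt0.
- exact: mulr_ge0.
- exact: weight_eball_le.
Qed.

End weights_of_balls.

Section cut_off.
Context {R : realType} {n : nat}.
Notation V := (Rn R n).
Implicit Types (f : V -> R) (D : set V).

Definition cutoff f D : V -> R := (fun x => f x * \1_D x)%R.

Lemma cut_in f D x : D x -> cutoff f D x = f x.
Proof. by move=> Dx; rewrite /cutoff indicE mem_set// mulr1. Qed.

Lemma cut_out f D x : ~ D x -> cutoff f D x = 0%R.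
Proof. by move=> Dx; rewrite /cutoff indicE memNset// mulr0. Qed.

Lemma cutC f D : f = (fun x => cutoff f D x + cutoff f (~` D) x)%R.
Proof.
apply/funext => x; have [Dx|Dx] := pselect (D x).
  by rewrite cut_in// cut_out ?addr0// => /(_ Dx).
by rewrite cut_out// cut_in// add0r.
Qed.

Lemma measurable_L1 f : L1_compact_supp f -> measurable_fun [set: V] f.
Proof. by move=> [/integrableP[/measurable_EFinP]]. Qed.

Lemma cut_L1 f D : measurable D -> L1_compact_supp f -> L1_compact_supp (cutoff f D).
Proof.
move=> mD fL; have mf := measurable_L1 fL; case: fL => fi fc.
have le x : (`|cutoff f D x| <= `|f x|)%R.
  have [Dx|Dx] := pselect (D x); first by rewrite cut_in.
  by rewrite cut_out// normr0.
split.
  apply: le_integrable fi => //.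
    by apply/measurable_EFinP/measurable_funM => //; exact: measurable_indic.
  by move=> x _ /=; rewrite lee_fin.
apply: subclosed_compact fc _; first exact: closed_closure.
apply: closureS => x /=; apply: contraNneq => fx; move: (le x).
by rewrite fx normr0 normr_le0.
Qed.

(** The ball of radius [r] for the sup norm around a point of the Euclidean
ball is contained in the cube, where the cut-off function vanishes. *)
Lemma supp_cut_far f x0 r x : eball x0 r x ->
  ~ supp (cutoff f (~` ccube x0 (2 * r))) x.
Proof.
move=> xr; have r0 : (0 < r)%R.
  by apply: le_lt_trans xr; exact: sqrtr_ge0.
move=> /(_ _ (nbhsx_ballx x r r0)) [y [/= /eqP fy xy]]; apply: fy.
apply: cut_out; apply; apply/ccubeP => i.
have xi := le_lt_trans (coord_le_enorm (x - x0)%R i) xr.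
have := xy.2 ord0 i; rewrite /ball/= => yi; move: xi yi.
by rewrite !mxE !ltr_norml => /andP[? ?] /andP[? ?]; lra.
Qed.

End cut_off.

(** * The contribution of the part of f near the ball, and conclusion *)

Section near_and_splitting.
Context {R : realType} {n : nat}.
Notation V := (Rn R n).
Implicit Types (f w : V -> R) (D : set V).

Lemma measurable_Phi_weight f w (sigma : R) :
  measurable_fun [set: V] f -> measurable_fun [set: V] w ->
  measurable_fun [set: V] (fun x => Phi (`|f x| / sigma) * w x)%R.
Proof.
move=> mf mw; apply: measurable_funM; last exact: mw.
apply: measurableT_comp; first exact: measurable_Phi.
apply: measurable_funM; last exact: measurable_cst.
by apply: measurableT_comp; [exact: normr_measurable|exact: mf].
Qed.

Lemma Phi_cut_le f D (sigma : R) x : (0 < sigma)%R ->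
  (Phi (`|cutoff f D x| / sigma) <= Phi (`|f x| / sigma))%R.
Proof.
move=> s0; have [Dx|Dx] := pselect (D x); first by rewrite cut_in.
rewrite cut_out// normr0 mul0r {1}/Phi mul0r; apply: Phi_ge0.
by rewrite divr_ge0// ltW.
Qed.

Lemma near_part f w D (C0 sigma : R) : (0 < sigma)%R -> measurable D ->
  measurable_fun [set: V] f -> measurable_fun [set: V] w ->
  (forall x, 0 <= w x)%R ->
  C0%:E * \int[leb]_x (Phi (`|cutoff f D x| / (sigma / 2)) * w x)%R%:E <=
  (4 * `|C0|)%R%:E * \int[leb]_(x in D) (Phi (`|f x| / sigma) * w x)%R%:E.
Proof.
move=> s0 mD mf mw w0.
have P0 x : (0 <= Phi (`|f x| / sigma))%R by rewrite Phi_ge0// divr_ge0// ltW.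
have Pc0 x : (0 <= Phi (`|cutoff f D x| / (sigma / 2)))%R.
  by rewrite Phi_ge0// divr_ge0// divr_ge0// ltW.
apply: (@le_trans _ _ ((`|C0|)%R%:E *
    \int[leb]_x (Phi (`|cutoff f D x| / (sigma / 2)) * w x)%R%:E)).
  apply: lee_wpmul2r; last by rewrite lee_fin ler_norm.
  by apply: integral_ge0 => x _; rewrite lee_fin mulr_ge0.
have -> : (4 * `|C0|)%R%:E = (`|C0|)%R%:E * 4%:E by rewrite -EFinM mulrC.
rewrite -muleA; apply: lee_wpmul2l; first by rewrite lee_fin.
have mPw := measurable_Phi_weight sigma mf mw.
rewrite -ge0_integralZl//; last 2 first.
- by apply/measurable_EFinP; exact: measurable_funTS.
- by move=> x _; rewrite lee_fin mulr_ge0.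
rewrite [leRHS]integral_mkcond; apply: ge0_le_integralT => x.
  by rewrite lee_fin mulr_ge0.
rewrite patchE; case: ifPn => [/set_mem Dx|/negP nDx].
  rewrite cut_in// -EFinM lee_fin mulrA; apply: ler_wpM2r => //.
  have -> : (`|f x| / (sigma / 2) = `|f x| / sigma * 2)%R.
    by field; rewrite gt_eqF.
  by apply: Phi_double; rewrite divr_ge0// ltW.
rewrite cut_out; last by move=> Dx; apply: nDx; rewrite inE.
by rewrite normr0 mul0r /Phi !mul0r.
Qed.

Lemma sublinear_cut (T : (V -> R) -> V -> R) f D :
  linear_operator T \/ sublinear_operator T -> measurable D ->
  L1_compact_supp f -> {ae leb, forall x,
    (`|T f x| <= `|T (cutoff f D) x| + `|T (cutoff f (~` D)) x|)%R}.
Proof.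
move=> TT mD fL; have f1 := cut_L1 mD fL; have f2 := cut_L1 (measurableC mD) fL.
case: TT => [/(_ 1%R _ _ f1 f2)|/(_ _ _ f1 f2)]; last by rewrite -cutC.
have -> : (fun y => 1 * cutoff f D y + cutoff f (~` D) y)%R = f.
  by rewrite [RHS](cutC f D); apply/funext => y; rewrite mul1r.
by apply: filterS => x ->; rewrite mul1r; exact: ler_normD.
Qed.

End near_and_splitting.

Unset Implicit Arguments.

Theorem theorem1p1 (R : realType) (n : nat) (n_gt0 : (0 < n)%N)
    (kappa : R) (kappa_gt0 : (0 < kappa)%R) (kappa_lt1 : (kappa < 1)%R)
    (w : Rn R n -> R) (w_A1 : muckenhoupt_A1 w)
    (b : Rn R n -> R) (b_BMO : BMO b)
    (T : (Rn R n -> R) -> (Rn R n -> R))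
    (T_measurable : forall f : Rn R n -> R, L1_compact_supp f ->
      measurable_fun [set: Rn R n] (T f))
    (T_sublinear : linear_operator T \/ sublinear_operator T)
    (c2 : R)
    (T_kernel : forall f : Rn R n -> R, L1_compact_supp f ->
      forall x : Rn R n, ~ supp f x ->
      (`|T f x|%R)%:E <= c2%:E *
        \int[leb]_y (`|b x - b y| * `|f y| / enorm (x - y) ^+ n)%R%:E)
    (C0 : R)
    (T_weak : forall (sigma : R) (f : Rn R n -> R), (0 < sigma)%R ->
      L1_compact_supp f ->
      weight_measure w [set x | (sigma < `|T f x|)%R] <=
        C0%:E * \int[leb]_x (Phi (`|f x| / sigma) * w x)%R%:E) :
  exists C : R, (0 < C)%R /\
    forall (f : Rn R n -> R) (sigma : R) (B : set (Rn R n)),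
      L1_compact_supp f -> (0 < sigma)%R -> eucl_ball B ->
      (weight_measure w B `^ kappa)^-1 *
        weight_measure w [set x | B x /\ (sigma < `|T f x|)%R] <=
      C%:E * ereal_sup [set (weight_measure w B' `^ kappa)^-1 *
          \int[leb]_(x in B') (Phi (`|f x| / sigma) * w x)%R%:E
        | B' in eucl_ball].
Proof.
have [A wA] := muckenhoupt_cubes w_A1.
have w0 := A1_ge0 wA; have mw := A1_measurable wA; have u0 := A1_unit_vol_gt0 wA.
have mb := b_BMO.1.1.
have [beta [beta0 osc]] := bmo_cubes u0 b_BMO.
pose a c s := ball_mean b (cube_ball c s).
pose rate := @exp_rate R n A beta; pose K := exp_const A.
pose kc := @kernel_const R n A.
have rate0 : (0 < rate)%R := exp_rate_gt0 wA beta0.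
have K0 : (0 < K)%R := exp_const_gt0 wA.
have kc0 : (0 < kc)%R := kernel_const_gt0 wA.
have A0 := A1_const_gt0 wA.
have k0 := ltW kappa_gt0.
pose N := @ball_const R n A.
have N0 : (0 < N)%R := ball_const_gt0 wA.
(* [d] makes the exponential part of the tail at most a quarter of [sigma] *)
pose M := (`|c2| * kc * (4 * rate^-1 * K))%R.
have M0 : (0 <= M)%R by rewrite !mulr_ge0 ?invr_ge0// ltW.
pose d : R := (4 * (M + 1))^-1%R.
have d01 : (0 < d <= 1)%R.
  by rewrite /d invr_gt0 invf_le1; [apply/andP; split|]; lra.
have Md : (M * d <= 4^-1)%R.
  by rewrite /d ler_pdivrMr; lra.
pose Cfar := (4 * `|c2| * kc *
  (far_linear A kappa * rate^-1 * K + @far_log R n A beta kappa d))%R.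
pose Cnear := (4 * `|C0| * (A * 2 ^+ n) `^ kappa)%R.
have Cfar0 : (0 <= Cfar)%R.
  apply: mulr_ge0; first by rewrite !mulr_ge0// ltW.
  apply: addr_ge0; last exact: (far_log_ge0 wA beta0 kappa_lt1 d01).
  apply: mulr_ge0; last exact: ltW.
  by apply: mulr_ge0; [exact: (far_linear_ge0 wA kappa_lt1)|rewrite invr_ge0 ltW].
have Cnear0 : (0 <= Cnear)%R by rewrite !mulr_ge0// powR_ge0.
exists ((Cnear + Cfar) * (N `^ kappa * N `^ kappa) + 1)%R; split.
  by rewrite ltr_pwDr// mulr_ge0 ?addr_ge0// mulr_ge0 ?powR_ge0.
move=> f sigma B fL s0 [x0 [r [r0 ->]]]; rewrite -/(eball x0 r).
have mf := measurable_L1 fL.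
have P0 x : (0 <= Phi (`|f x| / sigma))%R by rewrite Phi_ge0// divr_ge0// ltW.
have mPw := measurable_Phi_weight sigma mf mw.
set G := (fun x => Phi (`|f x| / sigma) * w x)%R in mPw.
have G0 x : (0 <= G x)%R by rewrite mulr_ge0.
set Sup := ereal_sup _.
have Sle x h : (0 < h)%R -> (weight_measure w (eball x h) `^ kappa)^-1 *
    \int[leb]_(y in eball x h) (G y)%:E <= Sup.
  by move=> h0; apply: ereal_sup_ubound; exists (eball x h) => //; exists x, h.
have term0 x h : (0 < h)%R -> 0 <= (weight_measure w (eball x h) `^ kappa)^-1 *
    \int[leb]_(y in eball x h) (G y)%:E.
  move=> h0; apply: mule_ge0; last by apply: integral_ge0 => y _; rewrite lee_fin.
  by rewrite (poweR_weight_inv wA)// lee_fin invr_ge0 powR_ge0.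
have Sup0 : 0 <= Sup by exact: le_trans (term0 x0 r r0) (Sle x0 r r0).
have C1 : (0 < (Cnear + Cfar) * (N `^ kappa * N `^ kappa) + 1)%R.
  by rewrite ltr_pwDr// mulr_ge0 ?addr_ge0// mulr_ge0 ?powR_ge0.
(* an infinite supremum makes the right-hand side infinite, as [C] is positive *)
case: (Sup) Sle Sup0 => [S0| |//] Sle; last first.
  by move=> _; rewrite gt0_muley ?lte_fin// leey.
rewrite lee_fin => S00.
pose S := (S0 * N `^ kappa)%R.
have SS0 : (0 <= S)%R by rewrite mulr_ge0// powR_ge0.
have cube_bound h : (0 < h)%R -> \int[leb]_(y in ccube x0 h) (G y)%:E <=
    (S * ccubew w x0 h `^ kappa)%:E.
  move=> h0; apply: (morrey_cubes wA) => //.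
  by apply: Sle; rewrite mulr_gt0.
pose D : set (Rn R n) := ccube x0 (2 ^+ 1 * r)%R.
have mD : measurable D by exact: measurable_ccube.
have f1L := cut_L1 mD fL; have f2L := cut_L1 (measurableC mD) fL.
pose f1 := cutoff f D; pose f2 := cutoff f (~` D).
pose E := [set x | eball x0 r x /\ (sigma < `|T f x|)%R].
pose E1 := [set x | (sigma / 2 < `|T f1 x|)%R].
pose E2 := [set x | eball x0 r x /\ (sigma / 2 < `|T f2 x|)%R].
have mT (h : Rn R n -> R) (t : R) : L1_compact_supp h -> measurable [set x | (t < `|T h x|)%R].
  move=> hL; rewrite -[X in measurable X]setTI.
  have mTh : measurable_fun [set: Rn R n] (fun x => `|T h x|%R).
    by apply: measurableT_comp; [exact: normr_measurable|exact: T_measurable].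
  rewrite (_ : [set x | _] = (fun x => `|T h x|%R) @^-1` `]t, +oo[%classic).
    exact: mTh.
  by apply/seteqP; split => x /=; rewrite in_itv/= andbT.
have mB := measurable_eball x0 r.
have mE : measurable E by apply: measurableI => //; exact: mT.
have mE1 : measurable E1 by exact: mT.
have mE2 : measurable E2 by apply: measurableI => //; exact: mT.
have W0 := ccubew_gt0 wA x0 r0.
have near : weight_measure w E1 <= (Cnear * (S * ccubew w x0 r `^ kappa))%:E.
  have s20 : (0 < sigma / 2)%R by rewrite divr_gt0.
  apply: (le_trans (T_weak _ _ s20 f1L)).
  apply: (le_trans (near_part C0 s0 mD mf mw w0)).
  have D0 : (0 < 2 ^+ 1 * r)%R by rewrite mulr_gt0.
  apply: (@le_trans _ _ ((4 * `|C0|)%R%:E *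
      (S * ccubew w x0 (2 ^+ 1 * r) `^ kappa)%:E)).
    apply: lee_wpmul2l; first by rewrite lee_fin mulr_ge0.
    exact: cube_bound.
  rewrite -EFinM lee_fin /Cnear -mulrA; apply: ler_wpM2l; first by rewrite mulr_ge0.
  rewrite mulrCA; apply: ler_wpM2l => //.
  have A2 : (0 <= A * 2 ^+ n)%R by rewrite mulr_ge0 ?exprn_ge0// ltW.
  rewrite -powRM//; last exact: ltW.
  apply: ge0_ler_powR; rewrite ?nnegrE; first exact: k0.
  - exact: ltW (ccubew_gt0 wA x0 D0).
  - by rewrite mulr_ge0// ltW.
  - by rewrite expr1; apply: (ccubew_le wA) => //; rewrite ler1n.
have far : weight_measure w E2 <= (Cfar * (S * ccubew w x0 r `^ kappa))%:E.
  apply: (@far_estimate R n n_gt0 w A wA b a beta mb beta0 osc kappa kappa_lt1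
    x0 r S sigma `|c2|%R d (fun y => `|f2 y| / sigma)%R (T f2)
    r0 SS0 s0 (normr_ge0 c2) d01).
  - apply: measurable_funM; last exact: measurable_cst.
    by apply: measurableT_comp; [exact: normr_measurable|exact: measurable_L1].
  - by move=> y; rewrite divr_ge0// ltW.
  - by move=> y Dy; rewrite /f2 cut_out ?normr0 ?mul0r// => /(_ Dy).
  - move=> i; have hi0 : (0 < 2 ^+ i * r)%R by rewrite mulr_gt0// exprn_gt0.
    apply: le_trans (cube_bound _ hi0); apply: ge0_le_integral.
    + exact: measurable_ccube.
    + by move=> y _; rewrite lee_fin mulr_ge0// Phi_ge0// divr_ge0// ltW.
    + apply/measurable_EFinP; apply: measurable_funTS.
      by apply: measurable_Phi_weight; [exact: measurable_L1|exact: mw].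
    + by apply/measurable_EFinP; exact: measurable_funTS.
    + by move=> y _; rewrite lee_fin /G ler_wpM2r// Phi_cut_le.
  - exact: T_measurable.
  - move=> x xB; have nx : ~ supp f2 x.
      by rewrite /f2 /D expr1; exact: supp_cut_far.
    apply: (le_trans (T_kernel _ f2L _ nx)).
    under [in leRHS]eq_integral => y _ do rewrite [(sigma * _)%R]mulrC divfK ?gt_eqF//.
    apply: lee_wpmul2r; last by rewrite lee_fin ler_norm.
    apply: integral_ge0 => y _; rewrite lee_fin divr_ge0 ?mulr_ge0// exprn_ge0// sqrtr_ge0.
    by [].
  - by move: Md; rewrite /M !mulrA.
have WE : weight_measure w E <= ((Cnear + Cfar) * (S * ccubew w x0 r `^ kappa))%:E.
  rewrite mulrDl EFinD; apply: le_trans (leeD near far).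
  apply: le_trans (weight_measureU w0 mw mE1 mE2).
  apply: le_weight_measure_ae => //; first exact: measurableU.
  apply: filterS (sublinear_cut T_sublinear mD fL) => x le [xB big].
  have [h|h] := ltP (sigma / 2)%R (`|T f1 x|)%R; first by left.
  by right; split => //; move: le; rewrite -/f1 -/f2; lra.
have WB0 := weight_eball_gt0 wA x0 r0.
rewrite (poweR_weight_inv wA)// lee_pdivrMl ?powR_gt0//.
apply: (le_trans WE); rewrite -!EFinM lee_fin.
set wB := fine _ in WB0 *.
have Wp : (ccubew w x0 r `^ kappa <= N `^ kappa * wB `^ kappa)%R.
  rewrite -powRM ?(ltW N0) ?(ltW WB0)//; apply: ge0_ler_powR => //; rewrite ?nnegrE.
  - exact: ltW.
  - by rewrite mulr_ge0// ltW.
  - exact: (ccubew_le_eball wA).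
have CS : (0 <= (Cnear + Cfar) * S)%R by rewrite mulr_ge0// addr_ge0.
have := ler_wpM2l CS Wp; rewrite -mulrA => /le_trans; apply.
have h : (0 <= wB `^ kappa * S0)%R by rewrite mulr_ge0 ?powR_ge0.
rewrite /S -subr_ge0; move: (Cnear + Cfar)%R (N `^ kappa)%R (wB `^ kappa)%R h => p q z.
by congr (_ <= _)%R; ring.
Qed.
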